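(* Let $m,n\ge0$ be integers with $N=2m+n\ge1$. The Doob graph $\operatorname{Doob}(m,n)=\mathrm{Sh}^{\square m}\square K_4^{\square n}$ is distance-regular of diameter $N=2m+n$ with intersection numbers $$c_j=j,\qquad a_j=2j,\qquad b_j=3(N-j)\qquad(0\le j\le N).$$ At every root $a$, \begin{align*} \dim P_a&=N,\qquad \dim U_a^-=(n+1)\binom{m+3}{3}-1,\\ \delta_{\ominus}&=(n+1)\binom{m+3}{3}-1-N . \end{align*} Its orbit profile and graded defect are \begin{align*} \Omega_{m,n}(z)&=\left(\sum_{\alpha_0+\alpha_1+\alpha_2+\alpha_3=m}z^{\alpha_1+2\alpha_2+2\alpha_3}\right)(1+z+\cdots+z^n),\\ \Delta_{m,n}(z)&=\Omega_{m,n}(z)-(1+z+\cdots+z^N), \end{align*} where the summation indices $\alpha_0,\ldots,\alpha_3$ are nonnegative integers. In particular, the coefficient of $z^N$ in $\Delta_{m,n}(z)$ is $$[z^N]\Delta_{m,n}(z)=m .$$ The splitting $\delta_{\ominus}=\delta_{\mathrm{met}}+\delta_{\mathrm{orb}}$ into $\delta_{\mathrm{met}}=\dim Q_a^--\dim P_a$ and $\delta_{\mathrm{orb}}=\dim U_a^--\dim Q_a^-$ is \begin{align*} \delta_{\mathrm{met}}&=(n+1)\binom{m+2}{2}-1-N,\\ \delta_{\mathrm{orb}}&=(n+1)\left(\binom{m+3}{3}-\binom{m+2}{2}\right). \end{align*}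
   Context: All graphs are finite and simple; all vector spaces and algebras are over $\mathbb R$; $\square$ is the Cartesian product of graphs, $F^{\square m}$ the $m$-fold Cartesian power, and a block with exponent zero is omitted. The Shrikhande graph $\mathrm{Sh}$ is the Cayley graph on $\mathbb Z_4^2$ with connection set $\{\pm(1,0),\pm(0,1),\pm(1,1)\}$. For a distance-regular graph, a vertex at distance $j$ from a root has $b_j,c_j,a_j$ neighbours at distances $j+1,j-1,j$ from the root. For a connected regular graph $G$ with at least two vertices and $a\in V(G)$: $B=A(G-a)$ is the adjacency matrix of the vertex-deleted graph, $E$ is the diagonal matrix indexed by $V(G)\setminus\{a\}$ whose diagonal is the indicator of the neighbourhood $N(a)$, $\mathbf 1$ is the all-ones vector on $V(G)\setminus\{a\}$, $\mathcal B_a=\langle I,B,E\rangle$ is the real unital algebra generated by $B,E$, and $P_a=\mathcal B_a\mathbf 1$. $\operatorname{Aut}(G)_a$ is the stabilizer of $a$, $U_a^-=(\mathbb R^{V(G)\setminus\{a\}})^{\operatorname{Aut}(G)_a}$ is the space of vectors constant on $\operatorname{Aut}(G)_a$-orbits, and $\delta_{\ominus}=\delta_{\ominus}(G,a)=\dim U_a^--\dim P_a$. With $S_k(a)$ the sphere of radius $k$ at $a$, the distance-graded orbit profile is $\Omega_{G,a}(z)=\sum_{k\ge0}|\operatorname{Aut}(G)_a\backslash S_k(a)|\,z^k$ (the coefficient is the number of stabilizer orbits in $S_k(a)$). For a distance-regular graph $G$ of diameter $D$, the graded defect is $\Delta_{G,a}(z)=\Omega_{G,a}(z)-(1+z+\cdots+z^D)$.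 For $G=\operatorname{Doob}(m,n)$ these are written $\Omega_{m,n}$ and $\Delta_{m,n}$. For $G=\operatorname{Doob}(m,n)$ with root $a$, $Q_a^-$ is the span of the indicator vectors of the following cells partitioning $V(G)\setminus\{a\}$: two non-root vertices are in the same cell iff they have the same multiset of coordinate distances to $a$ in the $m$ Shrikhande coordinates and the same multiset of coordinate distances to $a$ in the $n$ $K_4$ coordinates. *)

(* Defs.v *)
From HB Require Import structures.
From mathcomp Require Import all_boot all_order all_algebra all_fingroup all_field.
From mathcomp Require Import reals.

Set Implicit Arguments.
Unset Strict Implicit.
Unset Printing Implicit Defensive.

Import GRing.Theory.

Local Open Scope ring_scope.

Record sgraph := SGraph {
  vertex :> finType;
  edge : rel vertex;
  edge_sym : symmetric edge;
  edge_irrefl : irreflexive edge }.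

Section Distance.
Local Open Scope nat_scope.
Variable G : sgraph.

Definition connected_graph := forall x y : G, connect (@edge G) x y.

Definition walk_of_length k (x y : G) :=
  [exists p : k.-tuple G, path (@edge G) x p && (last x p == y)].

(* The least length of a walk from x to y: two vertices joined by a walk are
   joined by one of length less than #|G|. The junk value is #|G|. *)
Definition gdist (x y : G) : nat :=
  find (fun k => walk_of_length k x y) (iota 0 #|G|).

Definition diameter : nat := \max_(x : G) \max_(y : G) gdist x y.

Definition sphere (k : nat) (a : G) : {set G} := [set x | gdist a x == k].

(* The condition for [c] is written with a successor on the left so that no
   vertex counts as being at distance -1 when j = 0. *)
Definition distance_regular_with (D : nat) (c a b : nat -> nat) : Prop :=
  [/\ connected_graph, diameter = D &
      forall x y : G, let j := gdist x y in
        [/\ #|[set z | edge y z & (gdist x z).+1 == j]| = c j,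
            #|[set z | edge y z & gdist x z == j]| = a j &
            #|[set z | edge y z & gdist x z == j.+1]| = b j]].

End Distance.

Section Constructions.
Variables G H : sgraph.

Definition box_edge : rel (G * H) := fun u v =>
  edge u.1 v.1 && (u.2 == v.2) || (u.1 == v.1) && edge u.2 v.2.

Lemma box_edge_sym : symmetric box_edge.
Proof.
move=> u v; rewrite /box_edge (edge_sym u.1) (edge_sym u.2).
by rewrite (eq_sym u.1) (eq_sym u.2).
Qed.

Lemma box_edge_irrefl : irreflexive box_edge.
Proof. by move=> u; rewrite /box_edge !edge_irrefl andbF. Qed.

Definition box : sgraph := SGraph box_edge_sym box_edge_irrefl.

Variable m : nat.

Definition power_edge : rel {ffun 'I_m -> G} := fun x y =>
  [exists i, edge (x i) (y i) && [forall j, (j != i) ==> (x j == y j)]].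

Lemma power_edge_sym : symmetric power_edge.
Proof.
move=> x y; apply: eq_existsb => i; rewrite edge_sym; congr (_ && _).
by apply: eq_forallb => j; rewrite eq_sym [y j == _]eq_sym.
Qed.

Lemma power_edge_irrefl : irreflexive power_edge.
Proof. by move=> x; apply/existsP => -[i]; rewrite edge_irrefl. Qed.

(* For m = 0 this is the one-vertex graph, the unit of [box] up to isomorphism,
   so a block with exponent zero may as well be omitted. *)
Definition power : sgraph := SGraph power_edge_sym power_edge_irrefl.

End Constructions.

Definition sh_conn : {set 'Z_4 * 'Z_4} :=
  [set (1, 0); - (1, 0); (0, 1); - (0, 1); (1, 1); - (1, 1)].

Lemma sh_conn0 : 0 \notin sh_conn.
Proof. by rewrite !inE. Qed.

Lemma sh_connN s : (- s \in sh_conn) = (s \in sh_conn).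
Proof.
rewrite !inE !eqr_opp ![- s == _]eqr_oppLR.
move: (s == (1, 0)) (s == - (1, 0)) (s == (0, 1)) (s == - (0, 1)).
move: (s == (1, 1)) (s == - (1, 1)).
by do 6!case.
Qed.

Definition sh_edge : rel ('Z_4 * 'Z_4) := fun x y => y - x \in sh_conn.

Lemma sh_edge_sym : symmetric sh_edge.
Proof. by move=> x y; rewrite /sh_edge -sh_connN opprB. Qed.

Lemma sh_edge_irrefl : irreflexive sh_edge.
Proof. by move=> x; rewrite /sh_edge subrr (negbTE sh_conn0). Qed.

Definition Shrikhande : sgraph := SGraph sh_edge_sym sh_edge_irrefl.

Section Complete.
Variable n : nat.
Definition complete_edge : rel 'I_n := fun x y => x != y.
Lemma complete_edge_sym : symmetric complete_edge.
Proof. by move=> x y; rewrite /complete_edge eq_sym. Qed.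
Lemma complete_edge_irrefl : irreflexive complete_edge.
Proof. by move=> x; rewrite /complete_edge eqxx. Qed.
Definition complete : sgraph := SGraph complete_edge_sym complete_edge_irrefl.
End Complete.

Definition Doob (m n : nat) : sgraph :=
  box (power Shrikhande m) (power (complete 4) n).

Section Automorphisms.
Variable G : sgraph.

Definition gaut : {set {perm G}} :=
  [set s : {perm G} | [forall x, forall y, edge (s x) (s y) == edge x y]].

Lemma gaut_group_set : group_set gaut.
Proof.
apply/group_setP; split=> [|s t]; rewrite !inE.
  by do 2!apply/forallP=> ?; rewrite !perm1.
move=> /forallP sP /forallP tP; apply/forallP=> x; apply/forallP=> y.
by rewrite !permM (eqP (forallP (tP _) _)) (eqP (forallP (sP _) _)).
Qed.

Canonical gaut_group : {group {perm G}} := Group gaut_group_set.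

Variable a : G.

Definition gstab : {set {perm G}} := ('C_(gaut)[a | 'P])%g.

Definition same_orbit : rel G := fun x y => y \in (orbit 'P gstab x)%g.

Definition sphere_orbits (k : nat) : {set {set G}} :=
  [set (orbit 'P gstab x)%g | x in sphere k a].

(* In a connected graph the spheres of radius at least #|G| are empty, so the
   truncation loses nothing. *)
Definition orbit_profile : {poly int} :=
  \poly_(k < #|G|) (#|sphere_orbits k|)%:Z.

Definition graded_defect : {poly int} :=
  orbit_profile - \sum_(k < (diameter G).+1) 'X^k.

End Automorphisms.

Section Deleted.
Variables (R : fieldType) (G : sgraph) (a : G).

(* Equal to #|V(G) \ {a}| as soon as G has two vertices (cf. [card_deleted]);
   the successor shape gives square matrices their algebra structure. *)
Definition ndel := #|G|.-2.+1.

Definition vtx (i : 'I_ndel) : G := nth a (enum (predC1 a)) i.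

Lemma card_deleted : (1 < #|G|)%N -> ndel = #|predC1 a|.
Proof.
by move=> G1; rewrite /ndel cardC1; case: #|_| G1 => [|[]].
Qed.

Lemma vtx_neq i : (1 < #|G|)%N -> vtx i != a.
Proof.
move=> G1; suff: vtx i \in enum (predC1 a) by rewrite mem_enum.
by rewrite mem_nth // -cardE -card_deleted.
Qed.

Lemma vtx_inj : (1 < #|G|)%N -> injective vtx.
Proof.
move=> G1 i j /eqP; rewrite nth_uniq ?enum_uniq -?cardE -?card_deleted //.
by move/eqP/val_inj.
Qed.

Lemma vtx_surj x : (1 < #|G|)%N -> x != a -> exists i, vtx i = x.
Proof.
move=> G1 xa; have xE: x \in enum (predC1 a) by rewrite mem_enum.
have ltx: (index x (enum (predC1 a)) < ndel)%N.
  by rewrite (card_deleted G1) cardE index_mem.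
by exists (Ordinal ltx); rewrite /vtx nth_index.
Qed.

Definition Bmx : 'M[R]_ndel := \matrix_(i, j) (edge (vtx i) (vtx j))%:R.

Definition Emx : 'M[R]_ndel := diag_mx (\row_i (edge a (vtx i))%:R).

Definition Balg : {vspace 'M[R]_ndel} := <<1 & [:: Bmx; Emx]>>%VS.

Definition Pspace : {vspace 'cV[R]_ndel} :=
  (linfun (mulmxr (const_mx 1 : 'cV[R]_ndel)) @: Balg)%VS.

Definition coord_diff (i j : 'I_ndel) : 'rV[R]_ndel :=
  delta_mx 0 i - delta_mx 0 j.

Definition constant_space (r : rel G) : {vspace 'cV[R]_ndel} :=
  (\bigcap_(p : 'I_ndel * 'I_ndel | r (vtx p.1) (vtx p.2))
     lker (linfun ((mulmx (coord_diff p.1 p.2) : 'cV[R]_ndel -> 'M[R]_1))))%VS.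

Lemma constant_spaceP (r : rel G) (v : 'cV[R]_ndel) :
  reflect (forall i j, r (vtx i) (vtx j) -> v i 0 = v j 0)
          (v \in constant_space r).
Proof.
have kerE p : (v \in lker (linfun (mulmx (coord_diff p.1 p.2))))
    = (v p.1 0 == v p.2 0).
  rewrite memv_ker lfunE /= mulmxBl -!rowE subr_eq0.
  apply/eqP/eqP=> [/matrixP/(_ 0 0)|vE]; first by rewrite !mxE.
  by apply/matrixP=> i j; rewrite !mxE !ord1.
rewrite memvE; apply: (iffP subv_bigcapP) => [vP i j rij | vP p rp].
  by apply/eqP; rewrite -(kerE (i, j)) memvE; apply: (vP (i, j)).
by rewrite -memvE kerE; apply/eqP/vP.
Qed.

Definition cell_span (r : rel G) : {vspace 'cV[R]_ndel} :=
  <<[seq (\col_i (r (vtx j) (vtx i))%:R : 'cV[R]_ndel) | j : 'I_ndel]>>%VS.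

Definition Uspace : {vspace 'cV[R]_ndel} := constant_space (same_orbit a).

Definition delta_ominus : int := (\dim Uspace)%:Z - (\dim Pspace)%:Z.

End Deleted.

Section DoobCells.
Variables (R : fieldType) (m n : nat) (a : Doob m n).

Definition same_cell : rel (Doob m n) := fun x y =>
  perm_eq [seq gdist (a.1 i) (x.1 i) | i : 'I_m]
          [seq gdist (a.1 i) (y.1 i) | i : 'I_m]
  && perm_eq [seq gdist (a.2 i) (x.2 i) | i : 'I_n]
             [seq gdist (a.2 i) (y.2 i) | i : 'I_n].

Definition Qspace := cell_span R a same_cell.

Definition delta_met : int := (\dim Qspace)%:Z - (\dim (Pspace R a))%:Z.

Definition delta_orb : int := (\dim (Uspace R a))%:Z - (\dim Qspace)%:Z.

End DoobCells.

(* Main.v *)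
Require Import Defs.
From HB Require Import structures.
From mathcomp Require Import all_boot all_order all_algebra all_fingroup all_field.
From mathcomp Require Import reals.
From mathcomp Require Import zify ring.

Set Implicit Arguments.
Unset Strict Implicit.
Unset Printing Implicit Defensive.

Import GRing.Theory.

(** The Doob graph is a Cartesian product of factors [Shrikhande] and
    [complete 4], so the distance to the root is the sum of the coordinate
    distances ([gdist_sum]), and a clique formed by neighbours of a vertex moves
    one single coordinate. Hence every count of such cliques with prescribed
    distances to the root is a sum over the coordinates ([flag_count_sum]). For
    single neighbours the counts in the factors are linear in the distance,
    which gives the intersection numbers ([Doob_distance_regular]).

    In one Shrikhande factor the stabilizer of a vertex has four orbits: the
    vertex, its six neighbours, and two orbits of sizes 3 and 6 at distance 2;
    they are the orbits of a rotation of order six. In [complete 4] there are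
    two orbits. Equality of the two multisets of coordinate orbit types is
    sufficient for two vertices to be conjugate under the stabilizer of the
    root: permute the coordinates and act inside each of them
    ([profile_orbit]). It is also necessary ([orbit_profile_eq]), because each
    multiplicity is recovered from clique counts, which are invariant under all
    automorphisms of the Doob graph fixing the root. Pairs of adjacent neighbours of x at distances d and d+1 from the root, where d is
    the distance of x, count the coordinates at distance 1 in Shrikhande
    factors. Pairs of adjacent neighbours at distance d-1 count the larger of
    the two orbits at distance 2: there the two common neighbours with the root
    are adjacent, while for the smaller orbit they are not. Triangles of
    neighbours at distances d-1, d, d occur in the factors [complete 4] only.
    The distance d and the number of coordinates give the rest.

    So the orbits correspond to pairs of weak compositions, of m into four
    parts and of n into two parts, which are counted by binomial coefficients;
    grading them by the distance gives the orbit profile ([orbit_profile_sum]). The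
    metric cells are counted in the same way, with three parts instead of four.
    The dimensions of the spaces of class functions are the numbers of classes
    ([dim_class_space]). Finally, in a distance-regular graph the vectors
    generated from the all-ones vector by the two matrices are the combinations
    of the indicators of the spheres ([Pspace_class_space]), by the three-term
    recurrence that the adjacency matrix satisfies on these indicators. *)

(** * Distances in a graph *)

Section Distances.
Variable G : sgraph.

(** Local conditions that determine the distance from [a] ([gdistE]); they are easy
    to verify for sums of distances, where shortest walks would be awkward. *)
Definition is_distance (a : G) (f : G -> nat) : Prop :=
  [/\ f a = 0, forall x, f x = 0 -> x = a,
      forall x y, edge x y -> f y <= (f x).+1 &
      forall x, 0 < f x -> exists2 y, edge x y & (f y).+1 = f x].

Lemma eq_is_distance a f g : f =1 g -> is_distance a f -> is_distance a g.
Proof.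
move=> fg [f0 f1 f2 f3]; split; first by rewrite -fg.
- by move=> x; rewrite -fg; apply: f1.
- by move=> x y /f2; rewrite !fg.
- by move=> x; rewrite -fg => /f3[y xy fy]; exists y; rewrite // -fg.
Qed.

Lemma distance_walk a f : is_distance a f ->
  forall k x, f x = k -> exists p, [/\ path (@edge G) a p, last a p = x & size p = k].
Proof.
case=> f0 f1 f2 f3; elim=> [|k IH] x fx.
  by exists [::]; rewrite /= (f1 _ fx).
have [|y xy fy] := f3 x; first by rewrite fx.
have [|p [pP pl ps]] := IH y; first by lia.
exists (rcons p x); rewrite rcons_path last_rcons size_rcons pP pl ps.
by rewrite edge_sym.
Qed.

Lemma distance_path_le a f : is_distance a f ->
  forall p x, path (@edge G) x p -> f (last x p) <= f x + size p.
Proof.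
case=> f0 f1 f2 f3; elim=> [|y p IH] x /=; first by rewrite addn0.
by case/andP=> /f2 xy /IH; lia.
Qed.

Lemma distance_lt_card a f x : is_distance a f -> f x < #|G|.
Proof.
move=> fP; have [p [pP pl _]] := distance_walk fP (erefl (f x)).
move: pl; case/shortenP: pP => q qP qU _ <-.
apply: leq_ltn_trans (distance_path_le fP qP) _.
case: fP => -> _ _ _; rewrite add0n.
by have := max_card (mem (a :: q)); rewrite (card_uniqP qU).
Qed.

(** A walk of length [f x] is built by descending; a shorter one is impossible
    because [f] grows by at most one along an edge. *)
Lemma gdistE a f : is_distance a f -> gdist a =1 f.
Proof.
move=> fP x; have [p [pP pl ps]] := distance_walk fP (erefl (f x)).
have ltG := distance_lt_card x fP.
have walkP k : reflect (exists q, [/\ path (@edge G) a q, last a q = x & size q = k])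
                 (walk_of_length k a x).
  apply: (iffP existsP) => [[q /andP[qP /eqP qx]]|[q [qP qx /eqP qs]]].
    by exists q; rewrite size_tuple.
  by exists (Tuple qs); rewrite /= qP qx eqxx.
have Wfx: walk_of_length (f x) a x by apply/walkP; exists p.
have hasW : has (fun k => walk_of_length k a x) (iota 0 #|G|).
  by apply/hasP; exists (f x); rewrite // mem_iota.
rewrite /gdist; set P := (fun k => _) in hasW *.
have lt_find : find P (iota 0 #|G|) < #|G| by rewrite -{2}(size_iota 0 #|G|) -has_find.
apply/eqP; rewrite eqn_leq; apply/andP; split.
  rewrite leqNgt; apply/negP => /(before_find 0).
  by rewrite nth_iota // /P add0n Wfx.
have /walkP[q [qP qx qs]] := nth_find 0 hasW.
move: qs; rewrite nth_iota // add0n -qx => <-.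
by have := distance_path_le fP qP; case: fP => ->; rewrite add0n qx.
Qed.

Lemma is_distance_gdist a f : is_distance a f -> is_distance a (gdist a).
Proof. by move=> fP; apply: eq_is_distance (fP) => x; rewrite (gdistE fP). Qed.

Lemma distance_connect a f x : is_distance a f -> connect (@edge G) a x.
Proof.
move=> fP; have [p [pP pl _]] := distance_walk fP (erefl (f x)).
by apply/connectP; exists p.
Qed.

(** The case of diameter at most two, which covers both kinds of factors. *)
Lemma is_distance_diam2 a :
    (forall x, x != a -> ~~ edge a x -> exists2 y, edge x y & edge a y) ->
  is_distance a (fun x => (x != a) + ((x != a) && ~~ edge a x)).
Proof.
move=> H; split; first by rewrite eqxx.
- by move=> x; case: eqP.
- move=> x y xy; case: (eqVneq x a) => [xa|xa] /=; last first.
    by case: (y != a); case: (edge a y).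
  by rewrite -xa xy andbF addn0; case: (y != x).
- move=> x; case: (eqVneq x a) => //= xa _; case axE: (edge a x) => /=.
    by exists a; rewrite ?eqxx // edge_sym.
  have [|y xy ay] := H x xa; first by rewrite axE.
  exists y => //; rewrite ay andbF; case: (eqVneq y a) ay => // ->.
  by rewrite edge_irrefl.
Qed.

Definition graph_auto (g : G -> G) : Prop :=
  bijective g /\ forall x y, edge (g x) (g y) = edge x y.

(** Transporting the distance from [g a] along [g] gives a function that satisfies
    the conditions characterizing the distance from [a]. *)
Lemma gdist_auto a g : (forall v : G, is_distance v (gdist v)) -> graph_auto g ->
  forall x, gdist (g a) (g x) = gdist a x.
Proof.
move=> dP [[h gK hK] gE] x; symmetry.
apply: (@gdistE a (fun x => gdist (g a) (g x))) x.
have [f0 f1 f2 f3] := dP (g a); split => //.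
- by move=> x /f1 /(can_inj gK).
- by move=> x y; rewrite -gE => /f2.
- move=> x /f3[y xy yE]; exists (h y); last by rewrite hK.
  by rewrite -gE hK.
Qed.

(** Ordered cliques w_1, ..., w_k inside [C], where w_i lies at distance
    d + s_i - 1 from the root [a]. The shift by one keeps the entries of [s]
    natural numbers: 0, 1 and 2 mean closer, equally far and farther. The
    recursion shrinks [C] by the neighbourhood of each chosen vertex, so that the
    additivity over coordinates can be proved by induction on [s]. *)
Fixpoint cliques (a : G) (d : nat) (s : seq nat) (C : pred G) : nat :=
  if s is e :: s' then
    \sum_(w | C w && ((gdist a w).+1 == d + e))
       cliques a d s' [pred z | C z && edge w z]
  else 1.

(** Cliques among the neighbours of [x], with distances taken relative to [x]. *)
Definition flag_count a s x := cliques a (gdist a x) s (edge x).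

Lemma eq_cliques a d s C C' : C =1 C' -> cliques a d s C = cliques a d s C'.
Proof.
elim: s C C' => //= e s IH C C' CC; apply: eq_big => [w|w _]; first by rewrite CC.
by apply: IH => z /=; rewrite CC.
Qed.

Lemma flag_count_auto g a s x :
    (forall v : G, is_distance v (gdist v)) -> graph_auto g ->
  flag_count (g a) s (g x) = flag_count a s x.
Proof.
move=> dP gP; rewrite /flag_count gdist_auto //; have [gB gE] := gP.
set d := gdist a x.
suff H C C': (forall z, C (g z) = C' z) -> cliques (g a) d s C = cliques a d s C'.
  by apply: H => z; rewrite gE.
elim: s C C' => //= e s IH C C' CC; rewrite (reindex g) /=; last exact: onW_bij.
apply: eq_big => [w|w _]; first by rewrite CC gdist_auto.
by apply: IH => z /=; rewrite CC gE.
Qed.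

(** The same count with sums over lists, so that it reduces to a numeral for a
    concrete graph. *)
Fixpoint cliques_list (V : seq G) (e : rel G) (f : G -> nat) d (s : seq nat)
    (C : pred G) : nat :=
  if s is i :: s' then
    sumn [seq cliques_list V e f d s' [pred z | C z && e w z] |
            w <- V & C w && ((f w).+1 == d + i)]
  else 1.

Lemma flag_countE (V : seq G) (e : rel G) (f : G -> nat) a s x :
    uniq V -> (forall v, v \in V) -> e =2 @edge G -> f =1 gdist a ->
  flag_count a s x = cliques_list V e f (f x) s (e x).
Proof.
move=> Vu Vt eE fE; rewrite /flag_count fE (eq_cliques _ _ _ (C' := e x)) //.
elim: s (e x) => //= i s IH C.
rewrite sumnE big_map big_filter; under [RHS]eq_bigl do rewrite fE.
under [RHS]eq_bigr => w _ do rewrite -IH.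
under [RHS]eq_bigr => w _.
  rewrite (eq_cliques _ _ _ (C' := [pred z | C z && edge w z])); last first.
    by move=> z /=; rewrite eE.
  over.
apply: perm_big; apply: uniq_perm; rewrite ?index_enum_uniq // => v.
by rewrite mem_index_enum Vt.
Qed.

Lemma flag_count1 a e x :
  flag_count a [:: e] x = #|[set z | edge x z & (gdist a z).+1 == gdist a x + e]|.
Proof. by rewrite /flag_count /= -sum1_card; apply: eq_bigl => z; rewrite inE. Qed.

End Distances.

(** * Automorphisms and orbits on pairs *)

Lemma graph_auto_comp (G : sgraph) (g h : G -> G) :
  graph_auto g -> graph_auto h -> graph_auto (g \o h).
Proof.
case=> gB gE [hB hE]; split; first exact: bij_comp.
by move=> x y /=; rewrite gE hE.
Qed.

Lemma graph_auto_inv (G : sgraph) (g : G -> G) :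
  graph_auto g -> exists2 h, cancel g h & graph_auto h.
Proof.
case=> [[h gK hK] gE]; exists h => //; split; first by exists g.
by move=> x y; rewrite -gE !hK.
Qed.

(** [tau] separates enough: equal values force two pairs to be conjugate, so the
    fibres of [tau] are contained in the orbits of the automorphism group on pairs. *)
Definition classifies_pairs (G : sgraph) (T : Type) (tau : G -> G -> T) : Prop :=
  forall a x b y, tau a x = tau b y ->
    exists g : G -> G, [/\ graph_auto g, g a = b & g x = y].

(** It suffices to bring each pair to a normal form depending only on its type. *)
Lemma classifies_pairsP (G : sgraph) (T : Type) (tau : G -> G -> T)
    (o : G) (rep : T -> G) :
    (forall a x, exists g : G -> G, [/\ graph_auto g, g a = o & g x = rep (tau a x)]) ->
  classifies_pairs tau.
Proof.
move=> H a x b y E; have [g [gA ga gx]] := H a x; have [h [hA hb hy]] := H b y.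
have [h' hK h'A] := graph_auto_inv hA; exists (h' \o g); split => /=.
- exact: graph_auto_comp.
- by rewrite ga -hb hK.
- by rewrite gx E -hy hK.
Qed.

(** * Cartesian products in coordinates *)

(** A Cartesian product of a finite family of graphs, presented by its
    coordinates. The Doob graph is a product of two powers; this interface treats
    all its factors, of both kinds, uniformly and without casts. *)
Record coordinates (X : sgraph) (I : finType) (F : I -> sgraph) := Coordinates {
  proj : forall i, X -> F i;
  upd : X -> forall i, F i -> X;
  proj_inj : forall x y, (forall i, proj i x = proj i y) -> x = y;
  proj_upd : forall x i v, proj i (upd x v) = v;
  proj_upd_neq : forall x i j (v : F i), j != i -> proj j (upd x v) = proj j x;
  edge_proj : forall x y, edge x y = [exists i, edge (proj i x) (proj i y) &&
     [forall j, (j != i) ==> (proj j x == proj j y)]] }.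

Section Products.
Variables (X : sgraph) (I : finType) (F : I -> sgraph) (c : coordinates X F).
Local Notation "x .[ i ]" := (proj c i x).

Lemma upd_proj x i : upd c x (x.[i]) = x.
Proof.
apply: (proj_inj (c := c)) => j; case: (eqVneq j i) => [->|ji]; first by rewrite proj_upd.
by rewrite proj_upd_neq.
Qed.

Lemma edgeP x y :
  reflect (exists i, exists2 v : F i, edge (x.[i]) v & y = upd c x v) (edge x y).
Proof.
rewrite (edge_proj c); apply: (iffP existsP) => [[i /andP[xy /forallP H]]|[i [v xv ->]]].
  exists i, (y.[i]) => //; apply: (proj_inj (c := c)) => j.
  case: (eqVneq j i) => [->|ji]; first by rewrite proj_upd.
  by rewrite proj_upd_neq //; have /implyP/(_ ji)/eqP := H j.
exists i; rewrite proj_upd xv; apply/forallP=> j; apply/implyP=> ji.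
by rewrite proj_upd_neq.
Qed.

Lemma edge_upd x i (u v : F i) : edge (upd c x u) (upd c x v) = edge u v.
Proof.
apply/idP/idP => [|uv]; last first.
  apply/edgeP; exists i, v; first by rewrite proj_upd.
  apply: (proj_inj (c := c)) => j; case: (eqVneq j i) => [->|ji]; first by rewrite !proj_upd.
  by rewrite !proj_upd_neq.
rewrite (edge_proj c) => /existsP[j /andP[]].
case: (eqVneq j i) => [->|ji]; first by rewrite !proj_upd.
by rewrite !proj_upd_neq // edge_irrefl.
Qed.

Lemma edge_updr x i (v : F i) : edge x (upd c x v) = edge (x.[i]) v.
Proof. by rewrite -{1}(upd_proj x i) edge_upd. Qed.

(** Moving two different coordinates never gives adjacent vertices: this is why
    cliques among neighbours stay inside one coordinate direction. *)
Lemma edge_neq_upd x i j (u : F i) (v : F j) : j != i ->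
  edge (x.[i]) u -> edge (x.[j]) v -> ~~ edge (upd c x u) (upd c x v).
Proof.
move=> ji xu xv; rewrite (edge_proj c); apply/existsP=> -[k /andP[_ /forallP H]].
have neq (l : I) (w : F l) : edge (x.[l]) w -> x.[l] != w.
  by apply: contraL => /eqP <-; rewrite edge_irrefl.
case: (eqVneq k i) => ki.
  subst k; have /implyP/(_ ji) := H j; rewrite proj_upd_neq // proj_upd.
  by apply/negP; apply: neq.
have := H i; rewrite eq_sym ki /= proj_upd eq_sym proj_upd_neq; last by rewrite eq_sym.
by apply/negP; apply: neq.
Qed.

Hypothesis dF : forall i (v : F i), is_distance v (gdist v).

(** A coordinate that has not reached the root can be moved closer, and an edge
    changes one summand only. *)
Lemma sum_is_distance a : is_distance a (fun x => \sum_i gdist (a.[i]) (x.[i])).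
Proof.
split.
- by apply: big1 => i _; have [-> ] := dF (a.[i]).
- move=> x /eqP; rewrite sum_nat_eq0 => /forallP H.
  apply: (proj_inj (c := c)) => i; have [_ f1 _ _] := dF (a.[i]).
  by apply: f1; apply/eqP/(implyP (H i)).
- move=> x y /edgeP[i [v xv ->]]; rewrite (bigD1 i) //= [in X in _ <= X](bigD1 i) //=.
  rewrite proj_upd -addSn; apply: leq_add; first by have [_ _ f2 _] := dF (a.[i]); apply: f2.
  by apply/eq_leq/eq_bigr => j ji; rewrite proj_upd_neq.
- move=> x; rewrite lt0n sum_nat_eq0 negb_forall => /existsP[i /=].
  rewrite -lt0n; have [_ _ _ f3] := dF (a.[i]) => /f3[v xv vE].
  exists (upd c x v); first by rewrite edge_updr.
  rewrite (bigD1 i) //= [in RHS](bigD1 i) //= proj_upd -vE addSn; congr (_ + _).+1.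
  by apply: eq_bigr => j ji; rewrite proj_upd_neq.
Qed.

Lemma gdist_sum a x : gdist a x = \sum_i gdist (a.[i]) (x.[i]).
Proof. exact: gdistE (sum_is_distance a) x. Qed.

Lemma gdist_upd a x i (v : F i) e :
  ((gdist a (upd c x v)).+1 == gdist a x + e)
    = ((gdist (a.[i]) v).+1 == gdist (a.[i]) (x.[i]) + e).
Proof.
rewrite !gdist_sum (bigD1 i) //= [in X in _ == X](bigD1 i) //= proj_upd.
rewrite -addSn addnAC; under eq_bigr => j ji do rewrite proj_upd_neq //.
by rewrite eqn_add2r.
Qed.

(** Inside the line through [x] in direction [i] all other coordinates are those of
    [x]; they contribute equally to both distances and cancel. *)
Lemma cliques_upd a x i s (C : pred X) (Ci : pred (F i)) :
    (forall y, C y -> exists v : F i, y = upd c x v) ->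
    (forall v : F i, C (upd c x v) = Ci v) ->
  cliques a (gdist a x) s C = cliques (a.[i]) (gdist (a.[i]) (x.[i])) s Ci.
Proof.
elim: s C Ci => //= e s IH C Ci Cs CC.
rewrite (reindex_onto (fun v : F i => upd c x v) (fun y => y.[i])) /=; last first.
  by move=> y /andP[/Cs[v ->] _]; rewrite proj_upd.
apply: eq_big => [v|v _]; first by rewrite proj_upd eqxx andbT CC gdist_upd.
apply: IH => [y /andP[/Cs]|u] //=.
by rewrite CC edge_upd.
Qed.

(** The first vertex of the clique determines a direction, and by [edge_neq_upd]
    the other ones follow it. The empty list is excluded because the empty clique
    has no direction. *)
Lemma flag_count_sum a e s x :
  flag_count a (e :: s) x = \sum_i flag_count (a.[i]) (e :: s) (x.[i]).
Proof.
rewrite /flag_count /=.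
(* [dir i w]: the neighbour [w] of [x] differs from it in coordinate [i]. *)
pose dir i w := edge (x.[i]) (w.[i]) && (w == upd c x (w.[i])).
have dirP w : edge x w -> exists i, forall j, dir j w = (j == i).
  move=> /edgeP[i [v xv ->]]; exists i => j; rewrite /dir.
  case: (eqVneq j i) => [->|ji]; first by rewrite proj_upd xv eqxx.
  by rewrite proj_upd_neq // edge_irrefl.
have dirE i w : dir i w -> edge x w.
  by case/andP=> xw /eqP ->; rewrite edge_updr.
transitivity (\sum_w \sum_(i | dir i w && ((gdist a w).+1 == gdist a x + e))
    cliques a (gdist a x) s [pred z | edge x z && edge w z]).
  rewrite big_mkcond /=; apply: eq_bigr => w _.
  case: eqP => cw; last by rewrite andbF big_pred0 // => i; rewrite andbF.
  rewrite andbT; under eq_bigl do rewrite andbT.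
  case xw: (edge x w); last first.
    by rewrite big_pred0 // => i; apply/negP => /dirE; rewrite xw.
  by have [i /= iP] := dirP w xw; rewrite (big_pred1 i).
rewrite (exchange_big_dep xpredT) //=; apply: eq_bigr => i _.
rewrite (reindex_onto (fun v : F i => upd c x v) (fun y => y.[i])) /=; last first.
  by move=> w /andP[/andP[_ /eqP wE] _]; rewrite -wE.
apply: eq_big => [v|v]; rewrite /dir proj_upd !eqxx !andbT gdist_upd //.
case/andP=> xv _; apply: cliques_upd => [y /andP[/edgeP[j [u xu ->]]]|u] /=.
  case: (eqVneq j i) => [ji|ji]; first by subst j; exists u.
  by rewrite (negbTE (edge_neq_upd ji xv xu)).
by rewrite edge_upd edge_updr.
Qed.

End Products.

(** * The two kinds of factors *)

Section Shrikhande.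
Local Open Scope ring_scope.
Implicit Types z : 'Z_4 * 'Z_4.

Definition sh_vertices : seq ('Z_4 * 'Z_4) :=
  [seq (i, j) | i <- [:: 0; 1; 2; 3], j <- [:: 0; 1; 2; 3]].

Definition sh_steps : seq ('Z_4 * 'Z_4) :=
  [:: (1, 0); (3, 0); (0, 1); (0, 3); (1, 1); (3, 3)].

Lemma sh_connE z : (z \in sh_conn) = (z \in sh_steps).
Proof. by rewrite !inE -!orbA. Qed.

Lemma mem_sh_vertices z : z \in sh_vertices.
Proof. by case: z => [[[|[|[|[|//]]]] ?] [[|[|[|[|//]]]] ?]]. Qed.

Lemma sh_forall (P : pred ('Z_4 * 'Z_4)) : all P sh_vertices -> forall z, P z.
Proof. by move=> /allP H z; apply/H/mem_sh_vertices. Qed.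

(** Types 0 to 3 are the root, the steps of the Cayley graph, the three elements of
    order two, and the six other elements at distance 2. *)
Definition sh_type_from0 z : 'I_4 :=
  if z == 0 then inZp 0 else if z \in sh_steps then inZp 1
  else if z + z == 0 then inZp 2 else inZp 3.

Definition sh_type (a x : Shrikhande) : 'I_4 := sh_type_from0 ((x : 'Z_4 * 'Z_4) - a).

Definition sh_rep (t : 'I_4) : Shrikhande :=
  nth 0 [:: 0; (1, 0); (2, 0); (1, 2)] t.

(** A rotation of the hexagon of steps. It is linear, and its orbits on the group
    are the fibres of [sh_type_from0]. *)
Definition sh_rot (z : Shrikhande) : Shrikhande := (z.1 - z.2, z.1).

Lemma sh_rot_auto : graph_auto sh_rot.
Proof.
split.
  exists (fun z => (z.2, z.2 - z.1)) => -[z1 z2]; rewrite /sh_rot /=.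
    by rewrite opprB [z1 + _]addrC subrK.
  by rewrite opprB [z2 + _]addrC subrK.
move=> x y; rewrite /edge /= /sh_edge !sh_connE.
have -> : (sh_rot y - sh_rot x : 'Z_4 * 'Z_4) = sh_rot (y - x : 'Z_4 * 'Z_4).
  case: x y => [x1 x2] [y1 y2]; congr (_, _) => //=.
  by rewrite !opprB addrACA [RHS]addrACA [- y2 - x1]addrC.
apply/eqP; move: (_ - _); apply: sh_forall; by vm_compute.
Qed.

Lemma sh_shift_auto (t : 'Z_4 * 'Z_4) :
  graph_auto (fun z : Shrikhande => (z : 'Z_4 * 'Z_4) - t : Shrikhande).
Proof.
split; first by exists (fun z : 'Z_4 * 'Z_4 => z + t) => z /=; rewrite ?subrK ?addrK.
by move=> x y; rewrite /edge /= /sh_edge opprB addrA subrK.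
Qed.

(** Translate the root to 0 and then rotate: at most five rotations are needed. *)
Lemma sh_canon (a x : Shrikhande) :
  exists g : Shrikhande -> Shrikhande,
    [/\ graph_auto g, g a = 0 & g x = sh_rep (sh_type a x)].
Proof.
have rotI k : graph_auto (iter k sh_rot).
  elim: k => [|k IH]; first by split; first exists id.
  exact: graph_auto_comp sh_rot_auto IH.
have rot0 k : iter k sh_rot (0 : 'Z_4 * 'Z_4) = 0.
  by elim: k => //= k ->; rewrite /sh_rot subrr.
have [k kE] : exists k, iter k sh_rot ((x : 'Z_4 * 'Z_4) - a) = sh_rep (sh_type a x).
  rewrite /sh_type; move: (_ - _) => z.
  suff /hasP[k _ /eqP] :
      has (fun k => iter k sh_rot z == sh_rep (sh_type_from0 z)) (iota 0 6).
    by exists k.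
  move: z; apply: sh_forall; by vm_compute.
exists (iter k sh_rot \o (fun z : 'Z_4 * 'Z_4 => z - a)); split => //=.
  exact: graph_auto_comp (rotI k) (sh_shift_auto a).
by rewrite subrr.
Qed.

Lemma sh_type_classifies : classifies_pairs sh_type.
Proof. exact: classifies_pairsP sh_canon. Qed.

(** Every element of the group is 0, a step or a sum of two steps. *)
Lemma sh_is_distance (a : Shrikhande) :
  is_distance a (fun x => (x != a) + ((x != a) && ~~ edge a x))%N.
Proof.
apply: is_distance_diam2 => x; rewrite /edge /= /sh_edge.
rewrite -(subr_eq0 (x : 'Z_4 * 'Z_4)) => xa nx.
have [s [s1 s2]] : exists s, s \in sh_steps /\ (x : 'Z_4 * 'Z_4) - a - s \in sh_steps.
  rewrite sh_connE in nx; move: xa nx; move: (_ - _) => z.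
  suff H : [|| z == 0, z \in sh_steps | has (fun s => z - s \in sh_steps) sh_steps].
    by case/or3P: H => [->|->|/hasP[s]] // s1 s2; exists s.
  move: z; apply: sh_forall; by vm_compute.
exists ((a : 'Z_4 * 'Z_4) + s).
  by rewrite -sh_connN opprB opprD addrA sh_connE.
by rewrite addrC addKr sh_connE.
Qed.

Lemma sh_gdist_is_distance (v : Shrikhande) : is_distance v (gdist v).
Proof. exact: is_distance_gdist (sh_is_distance v). Qed.

Lemma sh_gdist (a x : Shrikhande) : gdist a x = minn (sh_type a x) 2.
Proof.
rewrite (gdistE (sh_is_distance a)) /= /edge /= /sh_edge -(subr_eq0 (x : 'Z_4 * 'Z_4)).
rewrite /sh_type sh_connE; move: (_ - _) => z; apply/eqP.
move: z; apply: sh_forall; by vm_compute.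
Qed.

(** By [sh_canon] the count depends on the type only, so it can be evaluated at one
    representative of each type. *)
Lemma sh_flag_count (a x : Shrikhande) s :
  flag_count a s x =
    cliques_list (G := Shrikhande) sh_vertices
       (fun x y => (y : 'Z_4 * 'Z_4) - x \in sh_steps)
       (fun z => minn (sh_type_from0 z) 2) (minn (sh_type a x) 2) s
       (fun y => (y : 'Z_4 * 'Z_4) - sh_rep (sh_type a x) \in sh_steps).
Proof.
have [g [gA ga gx]] := sh_canon a x.
rewrite -(flag_count_auto _ _ _ sh_gdist_is_distance gA) ga gx.
rewrite (@flag_countE Shrikhande sh_vertices
   (fun x y => (y : 'Z_4 * 'Z_4) - x \in sh_steps)
   (fun z => minn (sh_type_from0 z) 2)).
- congr cliques_list; case: (sh_type a x) => [[|[|[|[|//]]]] ?]; by vm_compute.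
- by vm_compute.
- exact: mem_sh_vertices.
- by move=> y z; rewrite /edge /= /sh_edge sh_connE.
- by move=> z; rewrite sh_gdist /sh_type subr0.
Qed.

(** In the hexagon of neighbours of [x] the distances relative to [x] read, around
    the hexagon: farther everywhere for type 0; -1, 0, +1, +1, +1, 0 for type 1;
    -1, 0, 0, -1, 0, 0 for type 2; -1, -1, 0, 0, 0, 0 for type 3. So adjacent pairs
    0, +1 occur only in type 1, at two places, and a pair -1, -1 only in type 3,
    where it has two orders. A hexagon has no triangle. *)
Lemma sh_flags (a x : Shrikhande) (t := sh_type a x : nat) :
  [/\ flag_count a [:: 0] x = minn t 2, flag_count a [:: 1] x = 2 * minn t 2,
      flag_count a [:: 2] x = 3 * (2 - minn t 2),
      flag_count a [:: 1; 2] x = 2 * (t == 1) &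
      flag_count a [:: 0; 0] x = 2 * (t == 3) /\ flag_count a [:: 0; 1; 1] x = 0]%N.
Proof.
rewrite {}/t !sh_flag_count; case: (sh_type a x) => [[|[|[|[|//]]]] ?]; by vm_compute.
Qed.

End Shrikhande.

Section K4.

Definition k4_type (a x : complete 4) : 'I_2 := if x == a then ord0 else ord_max.

Definition k4_rep (t : 'I_2) : complete 4 := if t == ord0 then ord0 else ord_max.

Definition k4_vertices : seq 'I_4 := [:: inZp 0; inZp 1; inZp 2; inZp 3].

Lemma k4_canon (a x : complete 4) : exists g : complete 4 -> complete 4,
  [/\ graph_auto g, g a = ord0 & g x = k4_rep (k4_type a x)].
Proof.
have permA (p : {perm complete 4}) : graph_auto p.
  split; first by exists (p^-1)%g => v; rewrite ?permK ?permKV.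
  by move=> u v; rewrite /edge /= /complete_edge (inj_eq perm_inj).
pose p := tperm a (ord0 : 'I_4).
rewrite /k4_rep /k4_type; case: (eqVneq x a) => [->|xa] /=.
  by exists p; rewrite tpermL; split.
have px0 : p x != (ord0 : 'I_4) by rewrite -(tpermL a (ord0 : 'I_4)) (inj_eq perm_inj).
exists (p * tperm (p x) (ord_max : 'I_4))%g; split; first exact: permA.
  by rewrite permM tpermL tpermD.
by rewrite permM tpermL.
Qed.

Lemma k4_type_classifies : classifies_pairs k4_type.
Proof. exact: classifies_pairsP k4_canon. Qed.

Lemma k4_is_distance (a : complete 4) :
  is_distance a (fun x => (x != a) + ((x != a) && ~~ edge a x)).
Proof.
apply: is_distance_diam2 => x; rewrite eq_sym => xa.
by rewrite /edge /= /complete_edge xa.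
Qed.

Lemma k4_gdist_is_distance (v : complete 4) : is_distance v (gdist v).
Proof. exact: is_distance_gdist (k4_is_distance v). Qed.

Lemma k4_gdist (a x : complete 4) : gdist a x = k4_type a x.
Proof.
rewrite (gdistE (k4_is_distance a)) /edge /= /complete_edge (eq_sym a) /k4_type.
by case: eqP.
Qed.

Lemma k4_flag_count (a x : complete 4) s :
  flag_count a s x =
    cliques_list (G := complete 4) k4_vertices (fun x y => x != y)
      (fun z => nat_of_bool (z != ord0))
      (k4_type a x) s (fun y => k4_rep (k4_type a x) != y).
Proof.
have [g [gA ga gx]] := k4_canon a x.
rewrite -(flag_count_auto _ _ _ k4_gdist_is_distance gA) ga gx.
rewrite (@flag_countE (complete 4) k4_vertices (fun x y => x != y)
  (fun z => nat_of_bool (z != ord0))) //.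
- by congr cliques_list; case: (k4_type a x) => [[|[|//]] ?].
- by case=> [[|[|[|[|//]]]] ?].
- by move=> z; rewrite k4_gdist /k4_type; case: (z == _).
Qed.

(** A vertex other than the root has one neighbour closer, the root, and two
    neighbours equally far; the latter complete the triangle in two orders. *)
Lemma k4_flags (a x : complete 4) (t := k4_type a x : nat) :
  [/\ flag_count a [:: 0] x = t, flag_count a [:: 1] x = 2 * t,
      flag_count a [:: 2] x = 3 * (1 - t),
      flag_count a [:: 1; 2] x = 0 &
      flag_count a [:: 0; 0] x = 0 /\ flag_count a [:: 0; 1; 1] x = 2 * t].
Proof.
rewrite {}/t !k4_flag_count; case: (k4_type a x) => [[|[|//]] ?]; by vm_compute.
Qed.

End K4.

(** * Histograms of types and automorphisms of powers *)

Section Histograms.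
Variables m k : nat.
Implicit Type tau : 'I_m -> 'I_k.

(** The multiset of the values of [tau], as its tuple of multiplicities. Every
    multiplicity is at most [m], so the use of [inord] loses nothing. *)
Definition hist tau : k.-tuple 'I_m.+1 :=
  [tuple inord #|[set i | tau i == j]| | j < k].

Lemma tnth_hist tau j : tnth (hist tau) j = #|[set i | tau i == j]| :> nat.
Proof.
by rewrite tnth_mktuple inordK // ltnS (leq_trans (max_card _)) ?card_ord.
Qed.

Lemma sum_hist tau (w : nat -> nat) :
  \sum_i w (tau i) = \sum_(j < k) w j * nth ord0 (hist tau) j.
Proof.
rewrite (partition_big tau xpredT) //=; apply: eq_bigr => j _.
rewrite (eq_bigr (fun=> w j)) => [|i /eqP -> //].
by rewrite sum_nat_const mulnC -(tnth_nth ord0 (hist tau) j) tnth_hist cardsE.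
Qed.

Lemma hist_partition tau : \sum_(j <- hist tau) (j : nat) = m.
Proof.
have := sum_hist tau (fun=> 1); rewrite sum1_card card_ord => /esym mE.
rewrite -[RHS]mE big_tuple.
by apply: eq_bigr => j _; rewrite mul1n (tnth_nth ord0).
Qed.

Lemma count_mem_image tau j :
  count_mem j [seq tau i | i : 'I_m] = #|[set i | tau i == j]|.
Proof.
rewrite count_map cardsE cardE -size_filter [in RHS]/enum_mem -enumT.
by congr size; apply: eq_filter => i; rewrite inE.
Qed.

Lemma hist_perm_eq tau tau' :
  (hist tau == hist tau') = perm_eq [seq tau i | i : 'I_m] [seq tau' i | i : 'I_m].
Proof.
apply/eqP/idP => [E|/seq.permP E].
  apply/allP => j _ /=; rewrite !count_mem_image -!tnth_hist E //.
apply: eq_from_tnth => j; apply: val_inj; rewrite /= !tnth_hist.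
by rewrite -!count_mem_image E.
Qed.

Lemma hist_permP tau tau' :
  hist tau = hist tau' -> exists p : {perm 'I_m}, forall i, tau i = tau' (p i).
Proof.
move/eqP; rewrite hist_perm_eq => /(@tuple_permP _ _ _ [tuple tau' i | i < m])[p pE].
exists p => i; have := congr1 (fun s => nth (tau i) s i) pE.
rewrite (nth_map i) ?size_enum_ord // nth_ord_enum => ->.
by rewrite (nth_map i) ?size_enum_ord // nth_ord_enum tnth_mktuple.
Qed.

(** Write each [j] as often as the tuple demands, and read the list as a function. *)
Lemma hist_surj (t : k.-tuple 'I_m.+1) :
  \sum_(j <- t) (j : nat) = m -> exists tau, hist tau = t.
Proof.
move=> tm; pose s := flatten [seq nseq (tnth t j) j | j <- enum 'I_k].
have ss : size s = m.
  rewrite size_flatten sumnE !big_map -[RHS]tm [RHS]big_tuple -enumT big_enum.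
  by apply: eq_bigr => j _; rewrite size_nseq.
pose S : m.-tuple 'I_k := tcast ss (in_tuple s).
have SE : S = s :> seq _ by rewrite val_tcast.
exists (tnth S); apply: eq_from_tnth => j; apply: val_inj; rewrite /= tnth_hist.
rewrite -count_mem_image.
have -> : [seq tnth S i | i : 'I_m] = s by rewrite -SE -[in RHS](map_tnth_enum S).
rewrite count_flatten sumnE !big_map -enumT big_enum /= (bigD1 j) //= count_nseq /= eqxx mul1n.
by rewrite big1 ?addn0 // => i ij; rewrite count_nseq /= (negbTE ij).
Qed.

End Histograms.

(** The possible histograms: weak compositions of [m] into [k] parts. *)
Definition partitions k m : {set k.-tuple 'I_m.+1} :=
  [set t : k.-tuple 'I_m.+1 | \sum_(j <- t) (j : nat) == m].

Lemma card_partitions m k :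
  #|partitions k.+1 m| = 'C(m + k, k).
Proof. by rewrite /partitions card_ord_partitions addnC. Qed.

Section Automorphisms.

Lemma power_auto (G : sgraph) m (p : {perm 'I_m}) (g : 'I_m -> G -> G) :
    (forall i, graph_auto (g i)) ->
  graph_auto (fun z : power G m => [ffun i => g (p i) (z (p i))] : power G m).
Proof.
move=> gA; have gI i : injective (g i) by case: (gA i) => /bij_inj.
split.
  apply: injF_bij => z z' /ffunP E; apply/ffunP => i.
  by have := E (p^-1 i)%g; rewrite !ffunE permKV => /gI.
move=> z z'; rewrite /edge /= /power_edge; apply/existsP/existsP => -[i /andP[zE /forallP H]].
  exists (p i); move: zE; rewrite !ffunE (gA (p i)).2 => -> /=.
  apply/forallP => j; apply/implyP => ji; have := H (p^-1 j)%g.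
  rewrite !ffunE permKV (inj_eq (gI j)) -(inj_eq (@perm_inj _ p)) permKV ji.
  by move/implyP; apply.
exists (p^-1 i)%g; rewrite !ffunE permKV (gA i).2 zE; apply/forallP => j.
rewrite !ffunE (inj_eq (gI _)) -(inj_eq (@perm_inj _ p)) permKV; exact: H.
Qed.

Lemma box_auto (G H : sgraph) (g : G -> G) (h : H -> H) :
  graph_auto g -> graph_auto h ->
  graph_auto (fun z : box G H => (g z.1, h z.2) : box G H).
Proof.
case=> gB gE [hB hE]; split.
  by apply: injF_bij => -[z1 z2] [z1' z2'] /= [/(bij_inj gB) -> /(bij_inj hB) ->].
move=> z z'; rewrite /edge /= /box_edge /= gE hE.
by rewrite (inj_eq (bij_inj gB)) (inj_eq (bij_inj hB)).
Qed.

(** Equal histograms are related by a permutation of the coordinates, and after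
    permuting each coordinate is corrected separately. *)
Lemma power_classifies (G : sgraph) m k (tau : G -> G -> 'I_k) (a x b y : power G m) :
    classifies_pairs tau ->
    hist (fun i => tau (a i) (x i)) = hist (fun i => tau (b i) (y i)) ->
  exists g : power G m -> power G m, [/\ graph_auto g, g a = b & g x = y].
Proof.
move=> tauP /esym /hist_permP[p pE].
have /fin_all_exists[g gP] i :
    exists g, [/\ graph_auto g, g (a i) = b (p^-1 i)%g & g (x i) = y (p^-1 i)%g].
  by apply: tauP; rewrite pE permKV.
exists (fun z : power G m => [ffun i => g (p i) (z (p i))] : power G m); split.
- by apply: power_auto => i; case: (gP i).
- by apply/ffunP => i; rewrite ffunE; case: (gP (p i)) => _ -> _; rewrite permK.
- by apply/ffunP => i; rewrite ffunE; case: (gP (p i)) => _ _ ->; rewrite permK.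
Qed.

Lemma same_orbitP (G : sgraph) (a x y : G) :
  reflect (exists g : G -> G, [/\ graph_auto g, g a = a & g x = y]) (same_orbit a x y).
Proof.
apply: (iffP orbitP) => [[s sS <-]|[g [[gB gE] ga gx]]].
  move: sS; rewrite !inE sub1set inE => /andP[/forallP sE /eqP sa].
  exists s; split => //; split; first by exists (s^-1)%g => z; rewrite ?permK ?permKV.
  by move=> u v; apply/eqP/(forallP (sE u)).
exists (perm (bij_inj gB)); last by rewrite /= apermE permE.
rewrite !inE sub1set inE /= apermE permE ga eqxx andbT.
by apply/forallP => u; apply/forallP => v; rewrite !permE gE.
Qed.

End Automorphisms.

(** * Class functions and distance-regular graphs *)

Section CellSpaces.
Variables (K : fieldType) (G : sgraph) (a : G).
Hypothesis G1 : 1 < #|G|.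
Local Open Scope ring_scope.
Local Notation ndel := (ndel G).
Local Notation vtx := (vtx a).

Lemma sum_vtx (F : G -> K) : \sum_(i < ndel) F (vtx i) = \sum_(z | z != a) F z.
Proof.
rewrite (reindex_onto vtx (fun z => inord (index z (enum (predC1 a))))).
  apply: eq_bigl => i; rewrite vtx_neq //= /vtx index_uniq ?inord_val ?eqxx //.
    by rewrite -cardE -(card_deleted a G1).
  exact: enum_uniq.
move=> z za; have zE : z \in enum (predC1 a) by rewrite mem_enum.
have ltz : (index z (enum (predC1 a)) < ndel)%N.
  by rewrite (card_deleted a G1) cardE index_mem.
by rewrite /Defs.vtx inordK ?nth_index.
Qed.

Section Classes.
Variables (T : finType) (phi : G -> T).

Definition class_indicator (t : T) : 'cV[K]_ndel := \col_i (phi (vtx i) == t)%:R.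

Definition vertex_classes : {set T} := [set phi x | x in predC1 a].

Definition class_tuple := [tuple class_indicator (enum_val i) | i < #|vertex_classes|].

Definition class_space : {vspace 'cV[K]_ndel} := <<class_tuple>>%VS.

Lemma mem_class_indicator t : t \in vertex_classes -> class_indicator t \in class_space.
Proof.
move=> tC; apply/memv_span/tnthP; exists (enum_rank_in tC t).
by rewrite tnth_mktuple enum_rankK_in.
Qed.

Lemma vtx_classes i : phi (vtx i) \in vertex_classes.
Proof. by apply: imset_f; rewrite inE vtx_neq. Qed.

Lemma classes_vtx t : t \in vertex_classes -> exists i, phi (vtx i) = t.
Proof.
case/imsetP=> x; rewrite inE => xa ->.
by have [i <-] := vtx_surj G1 xa; exists i.
Qed.

(** The indicators of the classes that meet the non-root vertices are free: each
    of them alone is nonzero at a representative of its class. *)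
Lemma dim_class_space : \dim class_space = #|vertex_classes|.
Proof.
suff /eqP -> : free class_tuple by rewrite size_tuple.
apply/freeP => k k0 i.
have [l lE] := classes_vtx (enum_valP i).
have := congr1 (fun v : 'cV[K]_ndel => v l 0) k0.
under [in LHS]eq_bigr => j _ do rewrite -tnth_nth tnth_mktuple.
rewrite summxE mxE (bigD1 i) //= big1 => [|j ji].
  by rewrite addr0 !mxE lE eqxx mulr1.
by rewrite !mxE lE (inj_eq enum_val_inj) eq_sym (negbTE ji) mulr0.
Qed.

Lemma cell_span_class_space (r : rel G) :
    (forall x y, r x y = (phi x == phi y)) ->
  cell_span K a r = class_space.
Proof.
move=> rE; apply/eqP; rewrite eqEsubv; apply/andP; split; apply/span_subvP => v.
  case/mapP=> j _ ->.
  have -> : \col_i (r (vtx j) (vtx i))%:R = class_indicator (phi (vtx j)).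
    by apply/colP => i; rewrite !mxE rE eq_sym.
  exact/mem_class_indicator/vtx_classes.
case/tnthP=> i ->; rewrite tnth_mktuple; have [j jE] := classes_vtx (enum_valP i).
apply/memv_span/mapP; exists j; first by rewrite mem_enum.
by apply/colP => l; rewrite !mxE rE jE eq_sym.
Qed.

Lemma constant_space_class_space (r : rel G) :
    (forall x y, r x y = (phi x == phi y)) ->
  constant_space K a r = class_space.
Proof.
move=> rE; apply/eqP; rewrite eqEsubv; apply/andP; split; last first.
  apply/span_subvP => v /tnthP[i ->]; rewrite tnth_mktuple.
  by apply/constant_spaceP => j l; rewrite rE !mxE => /eqP ->.
apply/subvP => v /constant_spaceP vP.
have /fin_all_exists[rp rpE] (i : 'I_#|vertex_classes|) :
    exists l, phi (vtx l) = enum_val i.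
  exact/classes_vtx/enum_valP.
have -> : v = \sum_(i < #|vertex_classes|) v (rp i) 0 *: class_indicator (enum_val i).
  apply/colP => l; rewrite summxE.
  rewrite (bigD1 (enum_rank_in (vtx_classes l) (phi (vtx l)))) //= big1 => [|j].
    rewrite !mxE enum_rankK_in ?vtx_classes // eqxx mulr1 addr0; apply: vP.
    by rewrite rE rpE enum_rankK_in ?vtx_classes.
  move=> ji; rewrite !mxE; case: eqP => [lE|_]; last by rewrite mulr0.
  by case/eqP: ji; apply: enum_val_inj; rewrite enum_rankK_in ?vtx_classes.
apply: memv_suml => i _; apply: memvZ; apply: mem_class_indicator; exact: enum_valP.
Qed.

End Classes.

Section DistanceRegular.
Variables (D : nat) (c alpha b : nat -> nat).
Hypothesis GD : distance_regular_with G D c alpha b.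
Hypothesis c_neq0 : forall j, (0 < j <= D)%N -> (c j)%:R != 0 :> K.
Hypothesis aD : is_distance a (gdist a).
Hypothesis ecc : exists x, gdist a x = D.

Lemma gdist_le_diameter x : (gdist a x <= D)%N.
Proof.
case: GD => _ <- _; apply: leq_trans (leq_bigmax a).
exact: (leq_bigmax (F := fun y => gdist a y)).
Qed.

Lemma gdist_attained j : (j <= D)%N -> exists x, gdist a x = j.
Proof.
move=> jD; have -> : j = (D - (D - j))%N by rewrite subKn.
elim: (D - j)%N => [|k [x xE]]; first by rewrite subn0.
have [x0|x0] := posnP (gdist a x); first by exists x; lia.
by case: aD => _ _ _ /(_ x x0)[y _ yE]; exists y; lia.
Qed.

Definition sphere_vector j : 'cV[K]_ndel := \col_i (gdist a (vtx i) == j)%:R.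

Lemma sphere_vector0 : sphere_vector 0 = 0.
Proof.
apply/colP => i; rewrite !mxE; case: eqP => // i0.
by case: aD => _ /(_ _ i0) /eqP; rewrite (negbTE (vtx_neq a i G1)).
Qed.

Lemma edge_root x : edge a x = (gdist a x == 1%N).
Proof.
case: aD => f0 f1 f2 f3; apply/idP/eqP => [ax|x1].
  have := f2 _ _ ax; rewrite f0; case E: (gdist a x) => [|[|//]] // _.
  by move: ax; rewrite (f1 _ E) edge_irrefl.
by have [|y xy [y0]] := f3 x; rewrite ?x1 // edge_sym -(f1 y) //; lia.
Qed.

Lemma Emx_sphere j : Emx K a *m sphere_vector j = (j == 1%N)%:R *: sphere_vector 1.
Proof.
apply/colP => i; rewrite mul_diag_mx !mxE edge_root.
have [->|j1] := eqVneq j 1%N; first by rewrite mul1r -natrM mulnb andbb.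
by rewrite mul0r; case: eqP => [->|_]; rewrite ?mul0r // eq_sym (negbTE j1) mulr0.
Qed.

Lemma Emx_one : Emx K a *m const_mx 1 = sphere_vector 1.
Proof. by apply/colP => i; rewrite mul_diag_mx !mxE mulr1 edge_root. Qed.

(** The three-term recurrence. A vertex counted by the left-hand side has a neighbour
    at distance j+1 from the root, so its own distance is j, j+1 or j+2. Deleting
    the root does not interfere, as it is not at distance j+1; for j = 0 the last
    term vanishes with [sphere_vector 0]. *)
Lemma Bmx_sphere j : Bmx K a *m sphere_vector j.+1 =
  (c j.+2)%:R *: sphere_vector j.+2 + (alpha j.+1)%:R *: sphere_vector j.+1
  + (b j)%:R *: sphere_vector j.
Proof.
apply/colP => i; rewrite !mxE; set y := vtx i.
under eq_bigr => l _ do rewrite !mxE -natrM mulnb.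
rewrite (sum_vtx (fun z => (edge y z && (gdist a z == j.+1))%:R)).
have -> : \sum_(z | z != a) (edge y z && (gdist a z == j.+1))%:R
    = #|[set z | edge y z & gdist a z == j.+1]|%:R :> K.
  rewrite -sum1_card natr_sum big_mkcond [RHS]big_mkcond; apply: eq_bigr => z _.
  rewrite inE; case: (eqVneq z a) => [->|_] /=; last by case: (_ && _).
  by case: aD => -> _ _ _; rewrite andbF.
case: GD => _ _ /(_ a y) /= [cE aE bE].
case: aD => _ _ f2 _.
have nE k : (forall z, edge y z -> (gdist a z == j.+1) = k z) ->
    [set z | edge y z & gdist a z == j.+1] = [set z | edge y z & k z].
  by move=> H; apply/setP => z; rewrite !inE; case yz: edge => //=; apply: H.
have [dy|d2] := eqVneq (gdist a y) j.+2.
  rewrite dy /= in cE aE bE *.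
  rewrite (nE (fun z => (gdist a z).+1 == j.+2)) // cE.
  by rewrite !(gtn_eqF, ltn_eqF) // mulr1 !mulr0 !addr0.
have [dy|d1] := eqVneq (gdist a y) j.+1.
  rewrite dy /= in cE aE bE *.
  by rewrite aE (@gtn_eqF j) // mulr1 !mulr0 addr0 add0r.
rewrite !mulr0 !add0r.
have [dy|d0] := eqVneq (gdist a y) j.
  by rewrite dy /= in cE aE bE *; rewrite bE mulr1.
rewrite mulr0 (_ : [set z | _ & _] = set0) ?cards0 //; apply/setP => z; rewrite !inE.
apply/negP => /andP[yz /eqP zj]; have := f2 _ _ yz.
by rewrite edge_sym in yz; have := f2 _ _ yz; lia.
Qed.

Definition sphere_class x : 'I_D.+1 := inord (gdist a x).

Lemma sphere_classE x : sphere_class x = gdist a x :> nat.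
Proof. by rewrite inordK // ltnS gdist_le_diameter. Qed.

Lemma sphere_class_indicator t : class_indicator sphere_class t = sphere_vector t.
Proof. by apply/colP => i; rewrite !mxE -(inj_eq val_inj) /= sphere_classE. Qed.

Lemma card_sphere_classes : #|vertex_classes sphere_class| = D.
Proof.
suff -> : vertex_classes sphere_class = [set~ ord0].
  by rewrite cardsC1 card_ord.
apply/setP => t; rewrite !inE; apply/imsetP/idP => [[x xa ->]|t0].
  rewrite inE in xa; rewrite -(inj_eq val_inj) /= sphere_classE.
  by apply: contraNneq xa => x0; case: aD => _ /(_ _ x0) -> _ _.
have [x xE] := gdist_attained (leq_ord t).
exists x; last by apply: val_inj; rewrite /= sphere_classE.
rewrite inE; apply: contraNneq t0 => xa; rewrite -(inj_eq val_inj) /= -xE xa.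
by case: aD => ->.
Qed.

Lemma sphere_vector_in_class_space j : sphere_vector j \in class_space sphere_class.
Proof.
case: j => [|j]; first by rewrite sphere_vector0 mem0v.
case: (leqP j.+1 D) => jD; last first.
  have -> : sphere_vector j.+1 = 0; last exact: mem0v.
  by apply/colP => i; rewrite !mxE ltn_eqF // (leq_ltn_trans (gdist_le_diameter _)).
have [x xE] := gdist_attained jD.
have -> : sphere_vector j.+1 = class_indicator sphere_class (sphere_class x).
  by rewrite sphere_class_indicator sphere_classE xE.
apply: mem_class_indicator; apply: imset_f; rewrite inE.
by apply: contra_eqN xE => /eqP ->; case: aD => ->.
Qed.

(** The first sphere is the image of the all-ones vector under [Emx]; the recurrence
    [Bmx_sphere] then produces each next sphere, since its coefficient is invertible. *)
Lemma Pspace_sphere_vector j : (j <= D)%N -> sphere_vector j \in Pspace K a.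
Proof.
have B_in : Bmx K a \in Balg K a by apply: seqv_sub_adjoin; rewrite !inE eqxx.
have E_in : Emx K a \in Balg K a by apply: seqv_sub_adjoin; rewrite !inE eqxx orbT.
have closed v : v \in Pspace K a -> Bmx K a *m v \in Pspace K a.
  case/memv_imgP => M MB ->; rewrite lfunE /= mulmxA.
  have -> : Bmx K a *m M *m const_mx 1 =
      linfun (mulmxr (const_mx 1 : 'cV[K]_ndel)) (Bmx K a * M).
    by rewrite lfunE.
  by apply: memv_img; rewrite /Balg -agenvM; apply: memv_mul.
have P1 : sphere_vector 1 \in Pspace K a.
  by rewrite -Emx_one; apply/memv_imgP; exists (Emx K a); rewrite ?lfunE.
(* The recurrence has order two, so two consecutive spheres are carried. *)
suff H k : (k <= j ->
    sphere_vector k \in Pspace K a /\ sphere_vector k.+1 \in Pspace K a)%N.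
  by move=> _; case: (H j).
elim: k => [|k IH] kj; first by rewrite sphere_vector0 mem0v.
have [Pk Pk1] := IH (ltnW kj); split => //.
case: (leqP k.+2 D) => kD; last first.
  have -> : sphere_vector k.+2 = 0; last exact: mem0v.
  by apply/colP => i; rewrite !mxE ltn_eqF // (leq_ltn_trans (gdist_le_diameter _)).
have -> : sphere_vector k.+2 = (c k.+2)%:R^-1 *:
   (Bmx K a *m sphere_vector k.+1 - (alpha k.+1)%:R *: sphere_vector k.+1
     - (b k)%:R *: sphere_vector k).
  rewrite Bmx_sphere addrAC !addrK.
  by rewrite scalerA mulVf ?scale1r // c_neq0.
by apply: memvZ; apply: memvB; [apply: memvB; [exact: closed|]|]; apply: memvZ.
Qed.

(** One inclusion is [Pspace_sphere_vector]. For the other one, the matrices sending the all-ones vector into the span of the spheres form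
    a subspace that contains 1 and is stable under left multiplication by
    the two generators, hence it contains the whole algebra. *)
Lemma Pspace_class_space : Pspace K a = class_space sphere_class.
Proof.
set W := class_space sphere_class; apply/eqP; rewrite eqEsubv; apply/andP; split; last first.
  apply/span_subvP => v /tnthP[i ->]; rewrite tnth_mktuple sphere_class_indicator.
  by apply: Pspace_sphere_vector; rewrite -ltnS.
have one_in : const_mx 1 \in W.
  rewrite /W -(constant_space_class_space (phi := sphere_class)
    (r := fun x y => sphere_class x == sphere_class y)) //.
  by apply/constant_spaceP => i j _; rewrite !mxE.
have stable (M : 'M[K]_ndel) : (forall j, M *m sphere_vector j \in W) ->
    forall w, w \in W -> M *m w \in W.
  move=> MW w wW.
  suff /subvP H : (linfun (mulmx M : 'cV[K]_ndel -> 'cV[K]_ndel) @: W <= W)%VS.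
    by have := H _ (memv_img _ wW); rewrite lfunE.
  rewrite limg_span; apply/span_subvP => v /mapP[u /tnthP[i ->] ->].
  by rewrite tnth_mktuple lfunE sphere_class_indicator; apply: MW.
pose V := (linfun (mulmxr (const_mx 1 : 'cV[K]_ndel)) @^-1: W)%VS.
have VE M : (M \in V) = (M *m const_mx 1 \in W) by rewrite -memv_preim lfunE.
suff BV : (Balg K a <= V)%VS.
  apply/subvP => v /memv_imgP[M MB ->]; rewrite lfunE -VE.
  exact: (subvP BV).
apply: agenv_sub_modl.
  by rewrite -memvE VE [_ *m _]mul1mx.
have mulV (M : 'M[K]_ndel) :
    (forall j, M *m sphere_vector j \in W) -> (<[M]> * V <= V)%VS.
  move=> MW; apply/prodvP => u v /vlineP[k ->]; rewrite !VE => vV.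
  by rewrite -scalerAl -scalemxAl -mulmxA memvZ // stable.
rewrite prodvDl prod1v subv_add subvv /= !span_cons span_nil addv0 prodvDl subv_add.
apply/andP; split; apply: mulV => j.
  case: j => [|j]; first by rewrite sphere_vector0 mulmx0 mem0v.
  rewrite Bmx_sphere; apply: memvD; [apply: memvD|];
    exact/memvZ/sphere_vector_in_class_space.
by rewrite Emx_sphere; apply/memvZ/sphere_vector_in_class_space.
Qed.

Lemma dim_Pspace : \dim (Pspace K a) = D.
Proof. by rewrite Pspace_class_space dim_class_space card_sphere_classes. Qed.

End DistanceRegular.

End CellSpaces.

Lemma card_image_vertex_classes (G : sgraph) (a : G) (T : finType) (phi : G -> T) :
    (forall x, phi x = phi a -> x = a) ->
  #|[set phi x | x in setT]| = #|vertex_classes a phi|.+1.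
Proof.
move=> phia; have -> : vertex_classes a phi = [set phi x | x in setT] :\ phi a.
  apply/setP => t; rewrite in_setD1; apply/imsetP/andP => [[x xa ->]|[ta /imsetP[x _ tE]]].
    split; last exact: imset_f.
    by rewrite inE in xa; apply: contraNneq xa => /phia ->.
  by exists x => //; rewrite inE; apply: contraNneq ta => <-; rewrite tE.
by rewrite [LHS](cardsD1 (phi a)) imset_f.
Qed.

(** * Doob graphs *)

Section Doob.
Variables m n : nat.

Definition Doob_factor (i : 'I_m + 'I_n) : sgraph :=
  if i is inl _ then Shrikhande else complete 4.

Definition Doob_proj (i : 'I_m + 'I_n) (x : Doob m n) : Doob_factor i :=
  match i with inl k => x.1 k | inr k => x.2 k end.

Definition Doob_upd (x : Doob m n) (i : 'I_m + 'I_n) : Doob_factor i -> Doob m n :=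
  match i with
  | inl k => fun v => ([ffun j => if j == k then v else x.1 j], x.2)
  | inr k => fun v => (x.1, [ffun j => if j == k then v else x.2 j])
  end.

Lemma Doob_proj_inj x y : (forall i, Doob_proj i x = Doob_proj i y) -> x = y.
Proof.
case: x y => [x1 x2] [y1 y2] H; congr (_, _); apply/ffunP => k.
  exact: H (inl k).
exact: H (inr k).
Qed.

Lemma Doob_proj_upd x i v : Doob_proj i (@Doob_upd x i v) = v.
Proof. by case: i v => k v; rewrite /= ffunE eqxx. Qed.

Lemma Doob_proj_upd_neq x i j (v : Doob_factor i) :
  j != i -> Doob_proj j (Doob_upd x v) = Doob_proj j x.
Proof. by case: i j v => i [] j v ji //=; rewrite ffunE ifN. Qed.

Lemma Doob_edge_proj (x y : Doob m n) :
  edge x y = [exists i, edge (Doob_proj i x) (Doob_proj i y) &&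
     [forall j, (j != i) ==> (Doob_proj j x == Doob_proj j y)]].
Proof.
case: x y => [x1 x2] [y1 y2].
have eq1 : (x1 == y1) = [forall j, x1 j == y1 j].
  by apply/eqP/eqfunP => [->|/ffunP].
have eq2 : (x2 == y2) = [forall j, x2 j == y2 j].
  by apply/eqP/eqfunP => [->|/ffunP].
rewrite /edge /= /box_edge /= eq1 eq2.
apply/idP/existsP => [/orP[/andP[/existsP[k /andP[xy /forallP H]] /forallP H']|]|].
- exists (inl k); apply/andP; split; [exact: xy|apply/forallP => -[] j; [exact: H|exact: H']].
- case/andP => /forallP H' /existsP[k /andP[xy /forallP H]].
  exists (inr k); apply/andP; split; [exact: xy|apply/forallP => -[] j; [exact: H'|exact: H]].
- case=> -[] k /= /andP[xy /forallP H]; apply/orP; [left|right]; apply/andP; split.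
  + apply/existsP; exists k; apply/andP; split; first exact: xy.
    by apply/forallP => j; apply: (H (inl j)).
  + by apply/forallP => j; apply: (H (inr j)).
  + by apply/forallP => j; apply: (H (inl j)).
  + apply/existsP; exists k; apply/andP; split; first exact: xy.
    by apply/forallP => j; apply: (H (inr j)).
Qed.

Definition Doob_coordinates : coordinates (Doob m n) Doob_factor :=
  Coordinates Doob_proj_inj Doob_proj_upd Doob_proj_upd_neq Doob_edge_proj.

End Doob.
Section DoobGraph.
Variables m n : nat.
Implicit Types a x y : Doob m n.

Lemma Doob_factor_is_distance (i : 'I_m + 'I_n) (v : Doob_factor i) :
  is_distance v (gdist v).
Proof. by case: i v => i v; [exact: sh_gdist_is_distance|exact: k4_gdist_is_distance]. Qed.

Lemma Doob_gdist a x : gdist a x =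
  \sum_(i < m) minn (sh_type (a.1 i) (x.1 i)) 2 + \sum_(i < n) k4_type (a.2 i) (x.2 i).
Proof.
rewrite (gdist_sum (Doob_coordinates m n)); last exact: Doob_factor_is_distance.
rewrite big_sumType /=; congr (_ + _); apply: eq_bigr => i _; first exact: sh_gdist.
exact: k4_gdist.
Qed.

Lemma Doob_is_distance a : is_distance a (gdist a).
Proof.
apply: is_distance_gdist (@sum_is_distance _ _ _ (Doob_coordinates m n) _ a).
exact: Doob_factor_is_distance.
Qed.

Lemma Doob_flag_count a e s x : flag_count a (e :: s) x =
  \sum_(i < m) flag_count (a.1 i : Shrikhande) (e :: s) (x.1 i)
  + \sum_(i < n) flag_count (a.2 i : complete 4) (e :: s) (x.2 i).
Proof.
rewrite (flag_count_sum (Doob_coordinates m n)) ?big_sumType //.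
exact: Doob_factor_is_distance.
Qed.

Lemma sh_type_surj (a : Shrikhande) t : exists v, sh_type a v = t.
Proof.
exists ((a : 'Z_4 * 'Z_4) + sh_rep t)%R; rewrite /sh_type [(a + _)%R]addrC addrK.
by case: t => [[|[|[|[|//]]]] ?]; apply: val_inj.
Qed.

Lemma k4_type_surj (a : complete 4) t : exists v, k4_type a v = t.
Proof.
case: (eqVneq t ord0) => [->|t0]; first by exists a; rewrite /k4_type eqxx.
exists (if a == ord0 :> 'I_4 then ord_max else ord0).
rewrite /k4_type; case: eqP => [E|_].
  by move: E; case: eqP => [->|E1 E2] //; case: E1.
by case: t t0 => [[|[|//]] ?] // _; apply: val_inj.
Qed.

Lemma Doob_vertex a (tau : 'I_m -> 'I_4) (kappa : 'I_n -> 'I_2) : exists x : Doob m n,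
  (forall i, sh_type (a.1 i) (x.1 i) = tau i) /\
  (forall i, k4_type (a.2 i) (x.2 i) = kappa i).
Proof.
have /fin_all_exists[x1 x1E] i : exists v, sh_type (a.1 i) v = tau i by exact: sh_type_surj.
have /fin_all_exists[x2 x2E] i : exists v, k4_type (a.2 i) v = kappa i by exact: k4_type_surj.
by exists (finfun x1, finfun x2); split => i; rewrite ffunE.
Qed.

Lemma Doob_gdist_le a x : gdist a x <= 2 * m + n.
Proof.
have -> : 2 * m + n = \sum_(i < m) 2 + \sum_(i < n) 1.
  by rewrite !sum_nat_const !card_ord muln1 mulnC.
rewrite Doob_gdist.
by apply: leq_add; apply: leq_sum => i _; [exact: geq_minr | rewrite -ltnS].
Qed.

(** All coordinates can be taken at the largest distance; type 3 is one of the two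
    possible choices in a Shrikhande factor. *)
Lemma Doob_antipode a : exists x, gdist a x = 2 * m + n.
Proof.
have [x [xE1 xE2]] := Doob_vertex a (fun=> inord 3) (fun=> ord_max).
exists x; rewrite Doob_gdist.
under eq_bigr do rewrite xE1 inordK //; under [X in _ + X]eq_bigr do rewrite xE2.
by rewrite !sum_nat_const !card_ord muln1 mulnC.
Qed.

Lemma Doob_diameter : diameter (Doob m n) = 2 * m + n.
Proof.
apply/eqP; rewrite eqn_leq; apply/andP; split.
  by apply/bigmax_leqP => x _; apply/bigmax_leqP => y _; apply: Doob_gdist_le.
pose a : Doob m n := (finfun (fun=> 0%R), finfun (fun=> ord0)).
have [x <-] := Doob_antipode a; apply: leq_trans (leq_bigmax a).
exact: (leq_bigmax (F := fun y => gdist a y)).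
Qed.

(** The counts of neighbours in a factor of diameter D at distance d are d, 2d and
    3(D - d), so their sums over the coordinates depend on the total distance only. *)
Lemma Doob_distance_regular : distance_regular_with (Doob m n) (2 * m + n)
  (fun j => j) (fun j => 2 * j) (fun j => 3 * (2 * m + n - j)).
Proof.
split; [|exact: Doob_diameter|].
  by move=> x y; apply: distance_connect (Doob_is_distance x).
move=> x y /=.
have cE : #|[set z | edge y z & (gdist x z).+1 == gdist x y]| = flag_count x [:: 0] y.
  by rewrite flag_count1; apply: eq_card => z; rewrite !inE addn0.
have aE : #|[set z | edge y z & gdist x z == gdist x y]| = flag_count x [:: 1] y.
  by rewrite flag_count1; apply: eq_card => z; rewrite !inE addn1 eqSS.
have bE : #|[set z | edge y z & gdist x z == (gdist x y).+1]| = flag_count x [:: 2] y.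
  by rewrite flag_count1; apply: eq_card => z; rewrite !inE addn2 eqSS.
rewrite cE aE bE !Doob_flag_count !Doob_gdist.
split.
- by congr (_ + _); apply: eq_bigr => i _;
    [case: (sh_flags (x.1 i) (y.1 i))|case: (k4_flags (x.2 i) (y.2 i))].
- rewrite mulnDr !big_distrr.
  by congr (_ + _); apply: eq_bigr => i _;
    [case: (sh_flags (x.1 i) (y.1 i))|case: (k4_flags (x.2 i) (y.2 i))].
- have E1 : \sum_(i < m) flag_count (x.1 i : Shrikhande) [:: 2] (y.1 i)
     + 3 * \sum_(i < m) minn (sh_type (x.1 i) (y.1 i)) 2 = 3 * (2 * m).
    have -> : 3 * (2 * m) = \sum_(i < m) 6 by rewrite sum_nat_const card_ord mulnA mulnC.
    rewrite big_distrr -big_split /=.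
    apply: eq_bigr => i _; case: (sh_flags (x.1 i) (y.1 i)) => _ _ -> _ _.
    by rewrite -mulnDr subnK ?geq_minr.
  have E2 : \sum_(i < n) flag_count (x.2 i : complete 4) [:: 2] (y.2 i)
     + 3 * \sum_(i < n) k4_type (x.2 i) (y.2 i) = 3 * n.
    have -> : 3 * n = \sum_(i < n) 3 by rewrite sum_nat_const card_ord mulnC.
    rewrite big_distrr -big_split /=.
    apply: eq_bigr => i _; case: (k4_flags (x.2 i) (y.2 i)) => _ _ -> _ _.
    by rewrite -mulnDr subnK // -ltnS.
  lia.
Qed.

Section Root.
Variable a : Doob m n.

(** The multisets of orbit types of the coordinates, which turn out to be the complete
    invariant of the orbits of the stabilizer of the root. *)
Definition profile x : 4.-tuple 'I_m.+1 * 2.-tuple 'I_n.+1 :=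
  (hist (fun i => sh_type (a.1 i) (x.1 i)), hist (fun i => k4_type (a.2 i) (x.2 i))).

Definition weight (p : 4.-tuple 'I_m.+1 * 2.-tuple 'I_n.+1) : nat :=
  \sum_(j < 4) minn j 2 * nth ord0 p.1 j + \sum_(j < 2) j * nth ord0 p.2 j.

Lemma gdist_weight x : gdist a x = weight (profile x).
Proof.
rewrite Doob_gdist /weight /=.
by rewrite -(sum_hist _ (fun j => minn j 2)) -(sum_hist _ id).
Qed.

Lemma profile_surj (p : 4.-tuple 'I_m.+1 * 2.-tuple 'I_n.+1) :
    \sum_(j <- p.1) (j : nat) = m -> \sum_(j <- p.2) (j : nat) = n ->
  exists x, profile x = p.
Proof.
case: p => t s /= /hist_surj[tau tE] /hist_surj[kappa sE].
have [x [xE1 xE2]] := Doob_vertex a tau kappa; exists x; rewrite -tE -sE.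
congr (_, _); apply: eq_from_tnth => j; apply: val_inj; rewrite /= !tnth_hist.
  by apply: eq_card => i; rewrite !inE xE1.
by apply: eq_card => i; rewrite !inE xE2.
Qed.

Lemma profile_orbit x y : profile x = profile y -> same_orbit a x y.
Proof.
move=> E; have [E1 E2] := (congr1 fst E, congr1 snd E); apply/same_orbitP.
have [g [gA ga gx]] := power_classifies sh_type_classifies E1.
have [h [hA ha hx]] := power_classifies k4_type_classifies E2.
exists (fun z => (g z.1, h z.2)); split; first exact: box_auto.
  by rewrite ga ha; case: (a).
by rewrite gx hx; case: (y).
Qed.

(** The clique counts below are preserved by an automorphism fixing the root; as
    linear functions of the multiplicities they give those of types 1 and 3 and the
    number of nonzero coordinates in [complete 4]. The distance then gives the
    multiplicity of type 2, and the number of coordinates that of type 0. *)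
Lemma orbit_profile_eq x y : same_orbit a x y -> profile x = profile y.
Proof.
case/same_orbitP => g [gA ga gx].
have flagE s : flag_count a s x = flag_count a s y.
  by rewrite -{2}ga -gx flag_count_auto //; exact: Doob_is_distance.
have distE : gdist a x = gdist a y.
  by rewrite -{2}ga -gx gdist_auto //; exact: Doob_is_distance.
have sumsh w (z : Doob m n) : \sum_(i < m) w (sh_type (a.1 i) (z.1 i) : nat) =
    \sum_(j < 4) w j * nth ord0 (profile z).1 j by rewrite -sum_hist.
have sumk4 w (z : Doob m n) : \sum_(i < n) w (k4_type (a.2 i) (z.2 i) : nat) =
    \sum_(j < 2) w j * nth ord0 (profile z).2 j by rewrite -sum_hist.
have shN (z : Doob m n) : m = \sum_(j < 4) 1 * nth ord0 (profile z).1 j.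
  by rewrite -(sumsh (fun=> 1)) sum1_card card_ord.
have k4N (z : Doob m n) : n = \sum_(j < 2) 1 * nth ord0 (profile z).2 j.
  by rewrite -(sumk4 (fun=> 1)) sum1_card card_ord.
have f12 (z : Doob m n) : flag_count a [:: 1; 2] z =
    \sum_(j < 4) 2 * (j == 1 :> nat) * nth ord0 (profile z).1 j.
  rewrite Doob_flag_count [X in _ + X]big1 ?addn0 -?(sumsh (fun j => 2 * (j == 1))).
    by apply: eq_bigr => i _; case: (sh_flags (a.1 i) (z.1 i)).
  by move=> i _; case: (k4_flags (a.2 i) (z.2 i)).
have f00 (z : Doob m n) : flag_count a [:: 0; 0] z =
    \sum_(j < 4) 2 * (j == 3 :> nat) * nth ord0 (profile z).1 j.
  rewrite Doob_flag_count [X in _ + X]big1 ?addn0 -?(sumsh (fun j => 2 * (j == 3))).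
    by apply: eq_bigr => i _; case: (sh_flags (a.1 i) (z.1 i)) => _ _ _ _ [].
  by move=> i _; case: (k4_flags (a.2 i) (z.2 i)) => _ _ _ _ [].
have f011 (z : Doob m n) : flag_count a [:: 0; 1; 1] z =
    \sum_(j < 2) 2 * j * nth ord0 (profile z).2 j.
  rewrite Doob_flag_count [X in X + _]big1 ?add0n -?(sumk4 (fun j => 2 * j)).
    by apply: eq_bigr => i _; case: (k4_flags (a.2 i) (z.2 i)) => _ _ _ _ [].
  by move=> i _; case: (sh_flags (a.1 i) (z.1 i)) => _ _ _ _ [].
move: (flagE [:: 1; 2]) (flagE [:: 0; 0]) (flagE [:: 0; 1; 1]) distE.
rewrite !f12 !f00 !f011 !gdist_weight /weight.
move: (shN x) (shN y) (k4N x) (k4N y).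
case: (profile x) (profile y) => [t s] [t' s'].
rewrite !big_ord_recl !big_ord0 /= /bump /= !add1n => m1 m2 n1 n2 e12 e00 e011 ed.
have et : forall j, j < 4 -> nth ord0 t j = nth ord0 t' j.
  move=> [|[|[|[|//]]]] _; apply: val_inj => /=; lia.
have es : forall j, j < 2 -> nth ord0 s j = nth ord0 s' j.
  by move=> [|[|//]] _; apply: val_inj => /=; lia.
by congr (_, _); apply: eq_from_tnth => j; rewrite !(tnth_nth ord0) ?et ?es.
Qed.

End Root.
End DoobGraph.
(** Both images are in bijection with the image of the pairing of [f] and [g]. *)
Lemma card_imset_kernel (S T T' : finType) (f : S -> T) (g : S -> T') (A : {set S}) :
    (forall x y, (f x == f y) = (g x == g y)) ->
  #|[set f x | x in A]| = #|[set g x | x in A]|.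
Proof.
move=> fg; pose h x := (f x, g x).
have -> : [set f x | x in A] = fst @: (h @: A).
  by rewrite -imset_comp; apply: eq_imset.
have -> : [set g x | x in A] = snd @: (h @: A).
  by rewrite -imset_comp; apply: eq_imset.
rewrite (card_in_imset (f := fst)) ?(card_in_imset (f := snd)) //
  => u v /imsetP[x _ ->] /imsetP[y _ ->] /= /eqP E; apply/eqP.
  by rewrite xpair_eqE fg E.
by rewrite xpair_eqE -fg E.
Qed.

(** * Orbits and cells in Doob graphs *)

Section Root.
Variables (m n : nat) (a : Doob m n).
Local Notation profile := (profile a).

Definition profiles := setX (partitions 4 m) (partitions 2 n).

Lemma card_profiles : #|profiles| = n.+1 * 'C(m + 3, 3).
Proof. by rewrite cardsX !card_partitions bin1 addn1 mulnC. Qed.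

Lemma profile_image : [set profile x | x in setT] = profiles.
Proof.
apply/setP => p; rewrite !inE; apply/imsetP/andP => [[x _ ->]|[/eqP p1 /eqP p2]].
  by rewrite /= !hist_partition !eqxx.
by have [x <-] := profile_surj a p1 p2; exists x.
Qed.

Lemma same_orbit_profile x y : same_orbit a x y = (profile x == profile y).
Proof. by apply/idP/eqP => [/orbit_profile_eq|/profile_orbit]. Qed.

Lemma gdist_eq0 x : gdist a x = 0 -> x = a.
Proof. by have [_ H _ _] := Doob_is_distance a; apply: H. Qed.

Lemma gdist_root : gdist a a = 0.
Proof. by have [] := Doob_is_distance a. Qed.

Lemma card_profile_classes : (#|vertex_classes a profile|).+1 = n.+1 * 'C(m + 3, 3).
Proof.
rewrite -card_profiles -profile_image -(@card_image_vertex_classes _ a) // => x E.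
by apply: gdist_eq0; rewrite gdist_weight E -gdist_weight gdist_root.
Qed.

Lemma card_sphere_orbits k :
  #|sphere_orbits a k| = #|[set p in profiles | weight p == k]|.
Proof.
rewrite /sphere_orbits (card_imset_kernel (g := profile)).
  congr #|pred_of_set _|; apply/setP => p; rewrite in_set.
  apply/imsetP/andP => [[x]|[pP /eqP pk]].
    rewrite inE => /eqP <- ->; rewrite -gdist_weight eqxx; split => //.
    by rewrite -profile_image imset_f.
  move: pP; rewrite -profile_image => /imsetP[x _ E].
  by exists x => //; rewrite inE gdist_weight -E pk.
move=> x y; rewrite -same_orbit_profile eq_sym; exact: orbit_eq_mem.
Qed.

(** Merging types 2 and 3 leaves the coordinate distance. *)
Definition cell_profile (x : Doob m n) : 3.-tuple 'I_m.+1 * 2.-tuple 'I_n.+1 :=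
  (hist (fun i => inord (minn (sh_type (a.1 i) (x.1 i)) 2)),
   hist (fun i => k4_type (a.2 i) (x.2 i))).

Lemma same_cell_profile x y : same_cell a x y = (cell_profile x == cell_profile y).
Proof.
rewrite /same_cell xpair_eqE !hist_perm_eq; congr (_ && _).
  have E (z : Doob m n) : [seq gdist (a.1 i) (z.1 i) | i : 'I_m] = map val
     [seq (inord (minn (sh_type (a.1 i) (z.1 i)) 2) : 'I_3) | i : 'I_m].
    rewrite -map_comp; apply: eq_map => i /=.
    by rewrite inordK ?sh_gdist // ltnS geq_minr.
  by rewrite !E; apply/idP/idP => [/(perm_map_inj val_inj)|/(perm_map val)].
have E (z : Doob m n) : [seq gdist (a.2 i) (z.2 i) | i : 'I_n] = map val
     [seq k4_type (a.2 i) (z.2 i) | i : 'I_n].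
  by rewrite -map_comp; apply: eq_map => i /=; rewrite k4_gdist.
by rewrite !E; apply/idP/idP => [/(perm_map_inj val_inj)|/(perm_map val)].
Qed.

Lemma card_cell_classes : (#|vertex_classes a cell_profile|).+1 = n.+1 * 'C(m + 2, 2).
Proof.
have -> : n.+1 * 'C(m + 2, 2) = #|setX (partitions 3 m) (partitions 2 n)|.
  by rewrite cardsX !card_partitions bin1 addn1 mulnC.
rewrite -(@card_image_vertex_classes _ a) => [|x E].
  congr #|pred_of_set _|; apply/setP => -[t s]; rewrite !inE.
  apply/imsetP/andP => [[x _ ->]|/= [/eqP/hist_surj[tau <-] /eqP/hist_surj[kappa <-]]].
    by rewrite /= !hist_partition !eqxx.
  have [x [xE1 xE2]] := Doob_vertex a (fun i => inord (tau i)) kappa; exists x => //.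
  congr (_, _); apply: eq_from_tnth => j; apply: val_inj; rewrite /= !tnth_hist.
    apply: eq_card => i; have ti : tau i < 3 := ltn_ord (tau i).
    have t2 : minn (tau i) 2 = tau i by apply/minn_idPl.
    by rewrite !inE xE1 inordK ?(leqW ti) // t2 inord_val.
  by apply: eq_card => i; rewrite !inE xE2.
apply: gdist_eq0.
rewrite -gdist_root !Doob_gdist.
have minE (z : Doob m n) : \sum_(i < m) minn (sh_type (a.1 i) (z.1 i)) 2 =
    \sum_(j < 3) j * nth ord0 (cell_profile z).1 j.
  rewrite -(sum_hist _ id); apply: eq_bigr => i _.
  by rewrite inordK // ltnS geq_minr.
have k4E (z : Doob m n) : \sum_(i < n) k4_type (a.2 i) (z.2 i) =
    \sum_(j < 2) j * nth ord0 (cell_profile z).2 j by rewrite -(sum_hist _ id).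
by rewrite !minE !k4E E.
Qed.

Local Open Scope ring_scope.

(** Two vertices of a sphere are in the same orbit exactly when their profiles agree,
    so the orbits in the sphere of radius k are the profiles of weight k. *)
Lemma orbit_profile_sum : orbit_profile a =
  (\sum_(t in partitions 4 m) 'X^(\sum_(j < 4) minn j 2 * nth ord0 t j)%N)
   * (\sum_(s in partitions 2 n) 'X^(\sum_(j < 2) j * nth ord0 s j)%N).
Proof.
rewrite big_distrlr /= pair_big /=; apply/polyP => k.
rewrite coef_poly coef_sum.
transitivity (#|sphere_orbits a k|%:Z).
  case: ltnP => // kG; suff -> : sphere_orbits a k = set0 by rewrite cards0.
  apply/setP => O; rewrite inE; apply/imsetP => -[x]; rewrite inE => /eqP xk.
  by have := distance_lt_card x (Doob_is_distance a); rewrite xk ltnNge kG.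
rewrite card_sphere_orbits -natz -sum1_card big_mkcond /= natr_sum [RHS]big_mkcond /=.
apply: eq_bigr => -[t s] _; rewrite !inE /=.
case: ((\sum_(j <- t) _ == m)%N && (\sum_(j <- s) _ == n)%N) => //=.
by rewrite -exprD coefXn -/(weight (t, s)) eq_sym; case: (k == _).
Qed.

End Root.

Section Sums.
Local Open Scope ring_scope.
Variable A : nmodType.

Lemma big_tuple_cons (T : finType) k (F : k.+1.-tuple T -> A) :
  \sum_t F t = \sum_x \sum_(t : k.-tuple T) F (cons_tuple x t).
Proof.
rewrite pair_big /= (reindex (fun p : T * k.-tuple T => cons_tuple p.1 p.2)) //=.
exists (fun t => (thead t, [tuple of behead t])) => [[x t] _|t _] /=.
  by congr (_, _); apply: val_inj.
by rewrite [RHS]tuple_eta.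
Qed.

Lemma big_tuple0 (T : finType) (F : 0.-tuple T -> A) : \sum_t F t = F [tuple].
Proof. by rewrite (big_pred1 [tuple]) // => t; rewrite [t]tuple0 /= eqxx. Qed.

Lemma big_tuple2 (T : finType) (F : 2.-tuple T -> A) :
  \sum_t F t = \sum_x \sum_y F [tuple x; y].
Proof.
rewrite big_tuple_cons; apply: eq_bigr => x _; rewrite big_tuple_cons.
by apply: eq_bigr => y _; rewrite big_tuple0; congr F; apply: val_inj.
Qed.

Lemma big_tuple4 (T : finType) (F : 4.-tuple T -> A) :
  \sum_t F t = \sum_x \sum_y \sum_z \sum_w F [tuple x; y; z; w].
Proof.
rewrite big_tuple_cons; apply: eq_bigr => x _; rewrite big_tuple_cons.
apply: eq_bigr => y _; rewrite big_tuple2; apply: eq_bigr => z _.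
by apply: eq_bigr => w _; congr F; apply: val_inj.
Qed.

Lemma sum_complement n (f : 'I_n.+1 -> A) :
  \sum_(i < n.+1) \sum_(j < n.+1 | (i + j)%N == n) f j = \sum_j f j.
Proof.
rewrite (exchange_big_dep xpredT) //=; apply: eq_bigr => j _.
rewrite (big_pred1 (rev_ord j)) // => i; apply/eqP/eqP => [E|->].
  by apply: val_inj => /=; lia.
by rewrite /= subSS subnK // -ltnS.
Qed.

End Sums.

Section Final.
Variables (m n : nat) (a : Doob m n).
Local Open Scope ring_scope.

Lemma orbit_profileE : orbit_profile a =
  (\sum_(i0 < m.+1) \sum_(i1 < m.+1) \sum_(i2 < m.+1)
     \sum_(i3 < m.+1 | (i0 + i1 + i2 + i3)%N == m)
        'X^(i1 + 2 * i2 + 2 * i3)%N) * (\sum_(k < n.+1) 'X^k).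
Proof.
rewrite orbit_profile_sum; congr (_ * _).
  rewrite big_mkcond big_tuple4; do 3![apply: eq_bigr => ? _].
  rewrite [RHS]big_mkcond; apply: eq_bigr => i3 _.
  rewrite inE !big_ord_recl big_ord0 /= !big_cons big_nil addn0 !addnA.
  by case: eqP => // _; congr ('X^_); lia.
rewrite big_mkcond big_tuple2 -[RHS]sum_complement; apply: eq_bigr => i _.
rewrite [RHS]big_mkcond; apply: eq_bigr => j _.
rewrite inE !big_ord_recl big_ord0 /= !big_cons big_nil addn0.
case: eqP => // _; congr ('X^_); rewrite /bump /=; lia.
Qed.

(** Largest distance forces i0 = i1 = 0 and k = n, which leaves the m + 1 choices of
    i2, with i3 = m - i2. *)
Lemma orbit_profile_top : (orbit_profile a)`_(2 * m + n) = m.+1%:Z.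
Proof.
rewrite orbit_profileE mulr_suml coef_sum.
have zero (k : nat) : k != (2 * m + n)%N -> ('X^k : {poly int})`_(2 * m + n) = 0.
  by rewrite coefXn eq_sym => /negbTE ->.
rewrite (bigD1 ord0) //= [X in _ + X]big1 ?addr0; last first.
  move=> i0 i0n; rewrite mulr_suml coef_sum big1 // => i1 _.
  rewrite mulr_suml coef_sum big1 // => i2 _; rewrite mulr_suml coef_sum big1 // => i3 s.
  rewrite mulr_sumr coef_sum big1 // => k _; rewrite -exprD zero //.
  have : (0 < i0)%N by rewrite lt0n.
  have := ltn_ord k; lia.
rewrite mulr_suml coef_sum (bigD1 ord0) //= [X in _ + X]big1 ?addr0; last first.
  move=> i1 i1n; rewrite mulr_suml coef_sum big1 // => i2 _.
  rewrite mulr_suml coef_sum big1 // => i3 s; rewrite mulr_sumr coef_sum big1 // => k _.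
  rewrite -exprD zero //; have : (0 < i1)%N by rewrite lt0n.
  have := ltn_ord k; lia.
rewrite mulr_suml coef_sum (eq_bigr (fun=> 1)) => [|i2 _].
  by rewrite sumr_const card_ord natz.
rewrite (big_pred1 (rev_ord i2)) => [|i3]; last first.
  have := ltn_ord i2; rewrite /= -val_eqE /=; lia.
rewrite mulr_sumr coef_sum (bigD1 ord_max) //= big1 => [|k kn].
  rewrite addr0 -exprD coefXn; case: eqP => //; have := ltn_ord i2; lia.
rewrite -exprD zero //; have := ltn_ord i2; have := ltn_ord k.
by move: kn; rewrite -val_eqE /=; lia.
Qed.

Lemma graded_defectE :
  graded_defect a = orbit_profile a - \sum_(k < (2 * m + n).+1) 'X^k.
Proof. by rewrite /graded_defect Doob_diameter. Qed.

Lemma graded_defect_top : (graded_defect a)`_(2 * m + n) = m%:Z.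
Proof.
rewrite graded_defectE coefB orbit_profile_top coef_sum (bigD1 ord_max) //= big1.
  by rewrite coefXn eqxx addr0; lia.
by move=> k; rewrite -val_eqE /= coefXn eq_sym => /negbTE ->.
Qed.

Variable K : numFieldType.
Hypothesis N_gt0 : (0 < 2 * m + n)%N.

Lemma card_Doob_gt1 : (1 < #|Doob m n|)%N.
Proof.
have [x xE] := Doob_antipode a.
by apply: leq_ltn_trans (distance_lt_card x (Doob_is_distance a)); rewrite xE.
Qed.

Lemma Doob_dim_Pspace : \dim (Pspace K a) = (2 * m + n)%N.
Proof.
apply: (dim_Pspace card_Doob_gt1 (Doob_distance_regular m n)).
- by move=> j /andP[j0 _]; rewrite Num.Theory.pnatr_eq0 -lt0n.
- exact: Doob_is_distance.
- exact: Doob_antipode.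
Qed.

Lemma Doob_dim_Uspace : (\dim (Uspace K a)).+1 = (n.+1 * 'C(m + 3, 3))%N.
Proof.
rewrite /Uspace (@constant_space_class_space K _ a card_Doob_gt1 _ (profile a)).
  by rewrite dim_class_space ?card_profile_classes //; apply: card_Doob_gt1.
exact: same_orbit_profile.
Qed.

Lemma Doob_dim_Qspace : (\dim (Qspace K a)).+1 = (n.+1 * 'C(m + 2, 2))%N.
Proof.
rewrite /Qspace (@cell_span_class_space K _ a card_Doob_gt1 _ (cell_profile a)).
  by rewrite dim_class_space ?card_cell_classes //; apply: card_Doob_gt1.
exact: same_cell_profile.
Qed.

End Final.

Local Open Scope ring_scope.
Theorem theorem7p5 (R : realType) (m n : nat) (hN : (0 < 2 * m + n)%N) :
  let N := (2 * m + n)%N in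
  distance_regular_with (Doob m n) N
    (fun j => j) (fun j => 2 * j)%N (fun j => 3 * (N - j))%N
  /\
  forall a : Doob m n,
  [/\ [/\ \dim (Pspace R a) = N,
          (\dim (Uspace R a))%:Z = (n.+1 * 'C(m + 3, 3))%:Z - 1 &
          delta_ominus R a = (n.+1 * 'C(m + 3, 3))%:Z - 1 - N%:Z],
      [/\ orbit_profile a =
            (\sum_(i0 < m.+1) \sum_(i1 < m.+1) \sum_(i2 < m.+1)
               \sum_(i3 < m.+1 | (i0 + i1 + i2 + i3)%N == m)
                 'X^(i1 + 2 * i2 + 2 * i3)%N)
            * (\sum_(k < n.+1) 'X^k),
          graded_defect a = orbit_profile a - \sum_(k < N.+1) 'X^k &
          (graded_defect a)`_N = m%:Z] &
      [/\ delta_ominus R a = delta_met R a + delta_orb R a,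
          delta_met R a = (n.+1 * 'C(m + 2, 2))%:Z - 1 - N%:Z &
          delta_orb R a = n.+1%:Z * ('C(m + 3, 3)%:Z - 'C(m + 2, 2)%:Z)]].
Proof.
move=> N; split=> [|a]; first exact: Doob_distance_regular.
have dimP := Doob_dim_Pspace a R hN.
have dimU := Doob_dim_Uspace a R hN; have dimQ := Doob_dim_Qspace a R hN.
have UE : (\dim (Uspace R a))%:Z = (n.+1 * 'C(m + 3, 3))%:Z - 1.
  by rewrite -dimU intS addrAC subrr add0r.
have QE : (\dim (Qspace R a))%:Z = (n.+1 * 'C(m + 2, 2))%:Z - 1.
  by rewrite -dimQ intS addrAC subrr add0r.
split; split.
- exact: dimP.
- exact: UE.
- by rewrite /delta_ominus UE dimP.
- exact: orbit_profileE.
- exact: graded_defectE.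
- exact: graded_defect_top.
- by rewrite /delta_ominus /delta_met /delta_orb; ring.
- by rewrite /delta_met QE dimP.
- by rewrite /delta_orb UE QE !PoszM; ring.
Qed.
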